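(* Suppose that $X$ is a cosimplicial space. Then the space $\mathrm{Tot}(X)$ is non-empty if and only if there is a cocycle $$\ast \xleftarrow{\simeq} U \to X,$$ i.e. a map of cosimplicial spaces $U\to X$ such that the map $U\to\ast$ is a weak equivalence.
   Context: $\mathbf{\Delta}$ is the category of finite ordinals and order-preserving maps. A cosimplicial space is a functor $\mathbf{\Delta}\to s\mathbf{Set}$; $X^n=X(\mathbf{n})$; $\ast$ is the terminal cosimplicial space. The injective model structure on cosimplicial spaces has as weak equivalences (resp. cofibrations) the maps $X\to Y$ such that each $X^n\to Y^n$ is a weak equivalence (resp. monomorphism) of simplicial sets; injective fibrations are the maps with the right lifting property with respect to trivial cofibrations. For an arbitrary cosimplicial space $X$, $\mathrm{Tot}(X)$ denotes the homotopy inverse limit: $\mathrm{Tot}(X)=\mathrm{holim}_{\mathbf{n}}X^n=\varprojlim_{\mathbf{n}}Z^n=\mathbf{hom}(\ast,Z)$, where $X\to Z$ is a (functorially chosen) injective fibrant model, i.e. a weak equivalence with $Z$ injective fibrant, and $\mathbf{hom}(\ast,Z)$ is the simplicial set whose $n$-simplices are the cosimplicial space maps $\ast\times\Delta^n\to Z$. *)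

(* Defs.v *)
From HB Require Import structures.
From mathcomp Require Import all_boot all_order boolp.
From Stdlib Require Import Relation_Operators.

Set Implicit Arguments.
Unset Strict Implicit.
Unset Printing Implicit Defensive.

Import Order.TTheory.

(* The object [n] = {0 < ... < n} of Delta is 'I_n.+1; the empty ordinal is not
   an object. *)
Definition dmap (m n : nat) : Type := {omorphism 'I_m.+1 -> 'I_n.+1}.

Definition did (n : nat) : dmap n n := [the {omorphism _ -> _} of idfun].

Definition dcomp m n p (g : dmap n p) (f : dmap m n) : dmap m p :=
  [the {omorphism _ -> _} of g \o f].

Lemma dmap_ext m n (f g : dmap m n) : f =1 g -> f = g.
Proof.
case: f g => [f [[hf]]] [g [[hg]]] /= /funext efg.
by move: hf hg; rewrite efg => hf hg; rewrite (Prop_irrelevance hf hg).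
Qed.

Lemma dcomp1f m n (f : dmap m n) : dcomp (did n) f = f.
Proof. exact: dmap_ext. Qed.

Lemma dcompf1 m n (f : dmap m n) : dcomp f (did m) = f.
Proof. exact: dmap_ext. Qed.

Lemma dcompA m n p q (h : dmap p q) (g : dmap n p) (f : dmap m n) :
  dcomp h (dcomp g f) = dcomp (dcomp h g) f.
Proof. exact: dmap_ext. Qed.

Definition dmk m n (f : 'I_m.+1 -> 'I_n.+1)
  (hf : {homo f : x y / (x <= y)%O}) : dmap m n :=
  HB.pack_for {omorphism 'I_m.+1 -> 'I_n.+1} f
    (Order.isOrderMorphism.Build _ _ _ _ f hf).

Definition dconst (m n : nat) (i : 'I_n.+1) : dmap m n :=
  @dmk m n (fun _ => i) (fun _ _ _ => lexx i).

Record sset : Type := SSet {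
  simp :> nat -> Type;
  sact : forall m n, dmap m n -> simp n -> simp m;
  sact1 : forall n (x : simp n), sact (did n) x = x;
  sactM : forall m n p (g : dmap n p) (f : dmap m n) (x : simp p),
    sact (dcomp g f) x = sact f (sact g x) }.

Record smap (X Y : sset) : Type := SMap {
  sapp :> forall n, X n -> Y n;
  snat : forall m n (f : dmap m n) (x : X n),
    sapp (sact f x) = sact f (sapp x) }.

Lemma smap_ext (X Y : sset) (f g : smap X Y) :
  (forall n (x : X n), f n x = g n x) -> f = g.
Proof.
case: f g => [f hf] [g hg] /= efg.
have {}efg : f = g by apply: functional_extensionality_dep => n; apply/funext/efg.
by move: hf hg; rewrite efg => hf hg; rewrite (Prop_irrelevance hf hg).
Qed.

Definition sid (X : sset) : smap X X :=
  @SMap X X (fun _ x => x) (fun _ _ _ _ => erefl).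

Program Definition scomp (X Y Z : sset) (g : smap Y Z) (f : smap X Y) :
  smap X Z := @SMap X Z (fun n x => g n (f n x)) _.
Next Obligation. by rewrite !snat. Qed.

Definition spoint : sset :=
  @SSet (fun _ => unit) (fun _ _ _ x => x)
    (fun _ _ => erefl) (fun _ _ _ _ _ _ => erefl).

Definition sterminal (X : sset) : smap X spoint :=
  @SMap X spoint (fun _ _ => tt) (fun _ _ _ _ => erefl).

Program Definition sprod (X Y : sset) : sset :=
  @SSet (fun n => (X n * Y n)%type)
    (fun _ _ f x => (sact f x.1, sact f x.2)) _ _.
Next Obligation. by rewrite !sact1. Qed.
Next Obligation. by rewrite !sactM. Qed.

Program Definition sprod_map (X X' Y Y' : sset) (f : smap X X')
  (g : smap Y Y') : smap (sprod X Y) (sprod X' Y') :=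
  @SMap (sprod X Y) (sprod X' Y') (fun n x => (f n x.1, g n x.2)) _.
Next Obligation. by rewrite !snat. Qed.

Definition simplex (n : nat) : sset :=
  @SSet (fun m => dmap m n) (fun _ _ f x => dcomp x f)
    (fun _ x => dcompf1 x) (fun _ _ _ g f x => dcompA x g f).

Program Definition simplex_map (m n : nat) (f : dmap m n) :
  smap (simplex m) (simplex n) :=
  @SMap (simplex m) (simplex n) (fun _ x => dcomp f x) _.
Next Obligation. by rewrite dcompA. Qed.

(* The union of the faces of Delta^n other than the one opposite to k:
   a simplex is in it iff it misses some vertex i <> k. *)
Definition in_horn (n : nat) (k : 'I_n.+1) (m : nat) (x : simplex n m) : Prop :=
  exists2 i : 'I_n.+1, i <> k & forall j : 'I_m.+1, x j <> i.

Lemma in_horn_act n (k : 'I_n.+1) m p (f : dmap p m) (x : simplex n m) :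
  in_horn k x -> in_horn k (sact f x).
Proof. by case=> i ik xi; exists i => // j; apply: xi. Qed.

Program Definition horn (n : nat) (k : 'I_n.+1) : sset :=
  @SSet (fun m => {x : simplex n m | in_horn k x})
    (fun _ _ f x => exist _ _ (in_horn_act f (proj2_sig x))) _ _.
Next Obligation. by apply: eq_exist; rewrite /= dcompf1. Qed.
Next Obligation. by apply: eq_exist; rewrite /= dcompA. Qed.

Definition horn_incl (n : nat) (k : 'I_n.+1) : smap (horn k) (simplex n) :=
  @SMap (horn k) (simplex n) (fun _ x => proj1_sig x) (fun _ _ _ _ => erefl).

Definition kan (K : sset) : Prop :=
  forall (n : nat) (k : 'I_n.+2) (h : smap (horn k) K),
  exists g : smap (simplex n.+1) K, scomp g (horn_incl k) = h.

Definition elementary_homotopy (X Y : sset) (f g : smap X Y) : Prop :=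
  exists H : smap (sprod X (simplex 1)) Y,
    (forall n (x : X n), H n (x, dconst n (ord0 : 'I_2)) = f n x) /\
    (forall n (x : X n), H n (x, dconst n (ord_max : 'I_2)) = g n x).

(* f and g lie in the same connected component of the mapping space. *)
Definition homotopic (X Y : sset) (f g : smap X Y) : Prop :=
  clos_refl_sym_trans (smap X Y) (@elementary_homotopy X Y) f g.

(* Weak homotopy equivalence: for every Kan complex K, precomposition with f
   is a bijection pi_0 hom(Y, K) -> pi_0 hom(X, K). *)
Definition weq (X Y : sset) (f : smap X Y) : Prop :=
  forall K : sset, kan K ->
    (forall g h : smap Y K,
       homotopic (scomp g f) (scomp h f) -> homotopic g h) /\
    (forall g : smap X K, exists h : smap Y K, homotopic (scomp h f) g).

Definition smono (X Y : sset) (f : smap X Y) : Prop :=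
  forall n, injective (f n).

Record cspace : Type := CSpace {
  clev :> nat -> sset;
  cact : forall m n, dmap m n -> smap (clev m) (clev n);
  cact1 : forall n, cact (did n) = sid (clev n);
  cactM : forall m n p (g : dmap n p) (f : dmap m n),
    cact (dcomp g f) = scomp (cact g) (cact f) }.

Record cmap (X Y : cspace) : Type := CMap {
  capp :> forall n, smap (X n) (Y n);
  cnat : forall m n (f : dmap m n),
    scomp (capp n) (cact X f) = scomp (cact Y f) (capp m) }.

Lemma cmap_ext (X Y : cspace) (f g : cmap X Y) :
  (forall n, f n = g n) -> f = g.
Proof.
case: f g => [f hf] [g hg] /= efg.
have {}efg : f = g by apply: functional_extensionality_dep.
by move: hf hg; rewrite efg => hf hg; rewrite (Prop_irrelevance hf hg).
Qed.

Lemma ccomp_nat (X Y Z : cspace) (g : cmap Y Z) (f : cmap X Y) m n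
  (t : dmap m n) :
  scomp (scomp (g n) (f n)) (cact X t) = scomp (cact Z t) (scomp (g m) (f m)).
Proof.
transitivity (scomp (g n) (scomp (f n) (cact X t))); first exact: smap_ext.
rewrite cnat; transitivity (scomp (scomp (g n) (cact Y t)) (f m)).
  exact: smap_ext.
by rewrite cnat; apply: smap_ext.
Qed.

Definition ccomp (X Y Z : cspace) (g : cmap Y Z) (f : cmap X Y) : cmap X Z :=
  @CMap X Z (fun n => scomp (g n) (f n)) (@ccomp_nat X Y Z g f).

Program Definition cpoint : cspace :=
  @CSpace (fun _ => spoint) (fun _ _ _ => sid spoint) _ _.
Next Obligation. exact: smap_ext. Qed.

Program Definition cterminal (X : cspace) : cmap X cpoint :=
  @CMap X cpoint (fun n => sterminal (X n)) _.
Next Obligation. exact: smap_ext. Qed.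

(* X * K with K regarded as a constant cosimplicial space. *)
Program Definition cprod (X : cspace) (K : sset) : cspace :=
  @CSpace (fun n => sprod (X n) K)
    (fun _ _ f => sprod_map (cact X f) (sid K)) _ _.
Next Obligation. by rewrite cact1; apply: smap_ext => k []. Qed.
Next Obligation. by rewrite cactM; apply: smap_ext. Qed.

Program Definition cprod_mapr (X : cspace) (K L : sset) (g : smap K L) :
  cmap (cprod X K) (cprod X L) :=
  @CMap (cprod X K) (cprod X L) (fun n => sprod_map (sid (X n)) g) _.
Next Obligation. exact: smap_ext. Qed.

(* n-simplices are the maps X * Delta^n -> Y. *)
Program Definition chom (X Y : cspace) : sset :=
  @SSet (fun n => cmap (cprod X (simplex n)) Y)
    (fun _ _ f x => ccomp x (cprod_mapr X (simplex_map f))) _ _.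
Next Obligation.
apply: cmap_ext => k; apply: smap_ext => p [a b] /=.
by rewrite dcomp1f.
Qed.
Next Obligation.
apply: cmap_ext => k; apply: smap_ext => q [a b] /=.
by rewrite dcompA.
Qed.

Definition cweq (X Y : cspace) (f : cmap X Y) : Prop := forall n, weq (f n).

Definition cofibration (X Y : cspace) (f : cmap X Y) : Prop :=
  forall n, smono (f n).

Definition injective_fibration (X Y : cspace) (p : cmap X Y) : Prop :=
  forall (A B : cspace) (i : cmap A B), cofibration i -> cweq i ->
  forall (a : cmap A X) (b : cmap B Y), ccomp p a = ccomp b i ->
  exists h : cmap B X, ccomp h i = a /\ ccomp p h = b.

Definition injective_fibrant (Z : cspace) : Prop :=
  injective_fibration (cterminal Z).

Record injective_fibrant_model (X : cspace) : Type := InjectiveFibrantModel {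
  model :> cspace;
  model_map : cmap X model;
  model_weq : cweq model_map;
  model_fibrant : injective_fibrant model }.

(* Tot(X), computed from an injective fibrant model M of X; a functorial choice
   of models is in particular a choice of one M for each X. *)
Definition Tot (X : cspace) (M : injective_fibrant_model X) : sset :=
  chom cpoint M.

Definition snonempty (X : sset) : Prop := exists n, inhabited (X n).

(* Main.v *)
(* A point of Tot gives a point z of an injective fibrant model M of X. Take U to
   be the levelwise homotopy fibre of X -> M over z: the pullback of X -> M along
   the fibration P -> M of paths ending at z. Its acyclicity is an instance of
   right properness, obtained as follows for a weak equivalence X -> M of
   simplicial sets with M Kan. Given a map phi from X x_M P to a Kan complex K,
   let Q -> M be the fibration whose fibre over m is the function complex from
   P_m to K; it is a fibration because pulling back along P -> M preserves strong
   homotopy equivalences. Then phi is a map X -> Q over M. As Q is Kan, this map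
   extends up to homotopy to M, in fact to a section of Q, that is to a map
   P -> K. The homotopy need not lie over M, but lifting its projection to P still
   shows that phi factors through P up to homotopy, and P is contractible. The
   case of empty K shows that X x_M P is not empty.

   Conversely, given an acyclic U -> X, embed U in a pointed acyclic cosimplicial
   space and extend U -> X -> M along the embedding. *)
From HB Require Import structures.
From mathcomp Require Import all_boot all_order boolp classical_sets zify.
From Stdlib Require Import Relation_Operators.
Require Import Defs.

Set Implicit Arguments.
Unset Strict Implicit.
Unset Printing Implicit Defensive.

Import Order.TTheory.

Local Notation interval := (simplex 1).

(** * Simplices and partial maps *)

Lemma dmap_le m n (f : dmap m n) (x y : 'I_m.+1) : (x <= y)%N -> (f x <= f y)%N.
Proof.
by move=> xy; have := @omorph_le _ _ _ _ f x y; rewrite !leEord => /(_ xy).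
Qed.

Lemma dmk_nat m n (f : 'I_m.+1 -> 'I_n.+1)
  (hf : forall x y : 'I_m.+1, (x <= y)%N -> (f x <= f y)%N) :
  exists g : dmap m n, g =1 f.
Proof.
have hf' : {homo f : x y / (x <= y)%O} by move=> x y; rewrite !leEord; exact: hf.
by exists (dmk hf').
Qed.

Definition misses m n (u : dmap m n) : Prop := exists v, forall j, u j <> v.

Lemma misses_comp k m n (u : dmap m n) (v : dmap k m) :
  misses u -> misses (dcomp u v).
Proof. by case=> w hw; exists w => j; apply: hw. Qed.

Lemma not_misses m n (u : dmap m n) : ~ misses u -> forall v, exists j, u j = v.
Proof.
move=> h v; apply: contrapT => hv; apply: h; exists v => j e; apply: hv.
by exists j.
Qed.

(** The coface [lift v] skips exactly the missed value. Faces thus come from lower dimensions, where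
    an induction hypothesis is available. *)
Lemma misses_factor m n (u : dmap m n) :
  misses u -> exists k (d : dmap k n) (w : dmap m k), (k < n)%N /\ u = dcomp d w.
Proof.
case: n u => [|n] u [v hv].
  by have := hv ord0; rewrite !ord1.
have [d hd] : exists d : dmap n n.+1, d =1 lift v.
  by apply: dmk_nat => x y xy /=; rewrite leq_bump2.
have [w hw] : exists w : dmap m n, forall j, lift v (w j) = u j.
  (* The default [ord0] never occurs, since [u j] differs from [v]. *)
  pose w j := odflt ord0 (unlift v (u j)).
  have e j : lift v (w j) = u j.
    rewrite /w; case: unliftP => [k -> //|/= e]; by case: (hv j).
  have [x y xy|w' hw'] := @dmk_nat m n w; last by exists w' => j; rewrite hw'.
  have e' j : bump v (w j) = u j by rewrite -(e j).
  by rewrite -(leq_bump2 v) !e' dmap_le.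
by exists n, d, w; split=> //; apply: dmap_ext => j /=; rewrite hd hw.
Qed.

(** Any choice of preimages is monotone because [u] is. Prescribing the value at [u j0] gives enough
    sections to tell maps apart. *)
Lemma dmap_section m n (u : dmap m n) (j0 : 'I_m.+1) : ~ misses u ->
  exists d : dmap n m, dcomp u d = did n /\ d (u j0) = j0.
Proof.
move=> /not_misses /choice[d hd].
pose d' v := if v == u j0 then j0 else d v.
have hd' v : u (d' v) = v by rewrite /d'; case: eqP.
have [x y xy|g hg] := @dmk_nat _ _ d'.
  rewrite leqNgt; apply/negP => lt; have := dmap_le u (ltnW lt).
  rewrite !hd' => yx; have e : x = y by apply/val_inj/eqP; rewrite eqn_leq xy yx.
  by move: lt; rewrite e ltnn.
by exists g; split; [apply: dmap_ext => v /=; rewrite hg hd'|rewrite hg /d' eqxx].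
Qed.

(** A surjective endomap of a finite set is bijective, so it carries the sorted enumeration to a
    sorted permutation of it, and the two coincide. *)
Lemma dmap_endo n (u : dmap n n) : ~ misses u -> u = did n.
Proof.
move=> hu; have [d [hd _]] := dmap_section ord0 hu.
have du : cancel d u by move=> v; rewrite -[RHS]/(did n v) -hd.
have /bij_inj inj : bijective u := bij_can_bij (injF_bij (can_inj du)) du.
pose le (x y : 'I_n.+1) := (x <= y)%N.
have sE : sorted le (enum 'I_n.+1).
  by have := iota_sorted 0 n.+1; rewrite -val_enum_ord sorted_map.
suff e : map u (enum 'I_n.+1) = map id (enum 'I_n.+1).
  by apply: dmap_ext => j; move/eq_in_map: e => /(_ j) -> //; rewrite mem_enum.
rewrite map_id; apply: (@sorted_eq _ le) => //.
- by move=> x y z; apply: leq_trans.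
- by move=> x y /anti_leq/val_inj.
- by apply: homo_sorted sE => x y; apply: dmap_le.
apply: uniq_perm => [||x].
- by rewrite map_inj_uniq // enum_uniq.
- exact: enum_uniq.
by rewrite mem_enum; apply/mapP; exists (d x); rewrite ?mem_enum ?du.
Qed.

(* The uniqueness half of the Eilenberg-Zilber lemma. *)
Lemma eilenberg_zilber (X : sset) n (x : X n) m (u u' : dmap m n) :
  (forall v : dmap n n, misses v -> sact v x <> x) ->
  ~ misses u -> sact u x = sact u' x -> u = u'.
Proof.
move=> hx hu e; apply: dmap_ext => j.
have [d [ud dj]] := dmap_section j hu.
have e' : sact (dcomp u' d) x = x by rewrite sactM -e -sactM ud sact1.
have u'd : dcomp u' d = did n.
  by apply: dmap_endo => /hx.
by rewrite -[in RHS]dj -[RHS]/(dcomp u' d (u j)) u'd.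
Qed.

Definition dom (Y K : sset) (G : forall n, Y n -> K n -> Prop) n (y : Y n) :=
  exists k, G n y k.

(** The graph of a map to [K] from the subcomplex [dom G] of [Y]. As a relation it is enlarged by
    disjunction, and chains have unions. *)
Definition partial_map (Y K : sset) (G : forall n, Y n -> K n -> Prop) : Prop :=
  (forall n y k k', G n y k -> G n y k' -> k = k') /\
  (forall m n (f : dmap m n) y k, G n y k -> G m (sact f y) (sact f k)).

Lemma dom_act Y K G m n (f : dmap m n) y :
  @partial_map Y K G -> dom G y -> dom G (sact f y).
Proof. by move=> [_ st] [k /(st _ _ f) hk]; exists (sact f k). Qed.

Lemma total_partial_map (Y K : sset) G : @partial_map Y K G ->
  (forall n y, @dom Y K G n y) -> exists f : smap Y K, forall n y, G n y (f n y).
Proof.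
move=> [fn st] tot; pose f n y := sval (cid (tot n y)).
have hf n y : G n y (f n y) by rewrite /f; case: cid.
have nat m n (u : dmap m n) y : f m (sact u y) = sact u (f n y).
  by apply: fn (hf _ _) (st _ _ _ _ _ (hf _ _)).
by exists (SMap nat).
Qed.

Definition yoneda (X : sset) n (x : X n) : smap (simplex n) X :=
  @SMap (simplex n) X (fun m u => sact u x) (fun _ _ f u => sactM u f x).

(** Gluing a cell: agreement on the old domain and injectivity of [s] off it keep the union of the
    two graphs single-valued. *)
Lemma attach_simplex (Y K : sset) G n (s : smap (simplex n) Y)
    (g : smap (simplex n) K) : @partial_map Y K G ->
  (forall m (u : simplex n m), dom G (s m u) -> G m (s m u) (g m u)) ->
  (forall m (u u' : simplex n m), ~ dom G (s m u) -> s m u = s m u' -> u = u') ->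
  @partial_map Y K
    (fun m y k => G m y k \/ exists2 u, y = s m u & k = g m u).
Proof.
move=> [fn st] agree inj; split.
  move=> m y k k' [Gk|[u -> ->]] [Gk'|[u' e' ->]].
  - exact: fn Gk Gk'.
  - by apply: (fn _ _ _ _ Gk); rewrite e'; apply: agree; rewrite -e'; exists k.
  - by apply/esym/(fn _ _ _ _ Gk'); apply: agree; exists k'.
  - have [d|nd] := pselect (dom G (s m u)); last by rewrite (inj _ _ _ nd e').
    by apply: fn (agree _ _ d) _; rewrite e'; apply: agree; rewrite -e'.
move=> m p f y k [Gk|[u -> ->]]; first by left; apply: st.
by right; exists (sact f u); rewrite snat.
Qed.

Lemma attach_horn (Y K : sset) G n (k : 'I_n.+2) (s : smap (simplex n.+1) Y) :
  kan K -> @partial_map Y K G -> smono s ->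
  (forall m u, dom G (s m u) <-> in_horn k u) ->
  exists G', [/\ @partial_map Y K G',
    forall m y z, G m y z -> G' m y z &
    forall m y, dom G' y <-> dom G y \/ exists u, y = s m u].
Proof.
move=> hK hG inj hdom; have [fn st] := hG.
pose h m (u : horn k m) := sval (cid ((hdom m _).2 (proj2_sig u))).
have hh m u : G m (s m (sval u)) (h m u) by rewrite /h; case: cid.
have nat m p (f : dmap m p) (u : horn k p) : h m (sact f u) = sact f (h p u).
  apply: fn (hh _ _) _; rewrite [sval _]/= -[dcomp _ _]/(sact f (sval u)) snat.
  exact: st.
have [g hg] := hK _ _ (SMap nat).
exists (fun m y z => G m y z \/ exists2 u, y = s m u & z = g m u); split.
- apply: attach_simplex => // [m u d|m u u' _]; last exact: inj.
  have hu := (hdom _ _).1 d.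
  have -> : g m u = h m (exist _ u hu) by rewrite -[RHS]/(SMap nat m _) -hg.
  exact: (hh m (exist _ u hu)).
- by left.
move=> m y; split=> [[z [Gz|[u -> _]]]|[[z Gz]|[u ->]]].
- by left; exists z.
- by right; exists u.
- by exists z; left.
- by exists (g m u); right; exists u.
Qed.

(** Zorn's lemma applies because [ok] constrains one value at a time and so survives unions of
    chains. *)
Lemma maximal_partial_map (Y K : sset) G0
    (ok : forall n, Y n -> K n -> Prop) :
  @partial_map Y K G0 -> (forall n y k, G0 n y k -> ok n y k) ->
  exists G, [/\ @partial_map Y K G, (forall n y k, G0 n y k -> G n y k),
    (forall n y k, G n y k -> ok n y k) &
    forall G', @partial_map Y K G' -> (forall n y k, G n y k -> G' n y k) ->
      (forall n y k, G' n y k -> ok n y k) -> forall n y k, G' n y k -> G n y k].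
Proof.
move=> [fn0 st0] ok0.
(* With [G0] added here, the empty chain has [G0] itself as its union. *)
pose rel (S : set {n & (Y n * K n)%type}) n y k :=
  G0 n y k \/ S (existT _ n (y, k)).
pose P S := @partial_map Y K (rel S) /\ forall n y k, rel S n y k -> ok n y k.
have [F FP tot|S [[hS okS] maxS]] := @Zorn_bigcup _ P.
  split; last by move=> n y k [/ok0//|[S FS Sk]]; apply: (FP _ FS).2; right.
  split=> [n y k k'|m n f y k].
    move=> [Gk|[S FS Sk]] [Gk'|[S' FS' Sk']]; first exact: fn0 Gk Gk'.
    - by have [[fn _] _] := FP _ FS'; apply: (fn n y); [left|right].
    - by have [[fn _] _] := FP _ FS; apply: (fn n y); [right|left].
    have [sub|sub] := tot _ _ FS FS'.
      by have [[fn _] _] := FP _ FS'; apply: (fn n y); right => //; apply: sub.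
    by have [[fn _] _] := FP _ FS; apply: (fn n y); right => //; apply: sub.
  move=> [Gk|[S FS Sk]]; first by left; apply: st0.
  have [[_ st] _] := FP _ FS.
  have [|Gf|Sf] := st _ _ f y k; [by right|by left|by right; exists S].
exists (rel S); split=> //; first by left.
move=> G' hG' sub okG' n y k Gk; apply: contrapT => nS.
pose S' : set {n & (Y n * K n)%type} := fun p => G' _ (projT2 p).1 (projT2 p).2.
have relE : rel S' = G'.
  apply: functional_extensionality_dep => a; apply/funext => b; apply/funext => c.
  rewrite propeqE; split; last by right.
  by case=> // G0c; apply: sub; left.
apply: (maxS S'); last by rewrite /P relE.
split=> [[a [b c]] Sc|/(_ (existT _ n (y, k)) Gk) Sk]; last by apply: nS; right.
by apply: sub; right.
Qed.

(** * Filling open prisms *)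

(* The stages of the prism Delta^n x Delta^1, from stage n+1, which is the open
   box, down to stage 0, which is everything. *)
Definition prism_stage n i m (y : sprod (simplex n) interval m) : Prop :=
  misses y.1 \/ forall j, y.2 j <> ord0 -> (i <= y.1 j)%N.

Lemma ord2_cases (x : 'I_2) : x = ord0 \/ x = ord_max.
Proof. by case: x => [[|[|?]] //= h]; [left|right]; apply: val_inj. Qed.

(* The nondegenerate (n+1)-simplex (0,0) < ... < (i,0) < (i,1) < ... < (n,1). *)
Definition shuffle n i (s : sprod (simplex n) interval n.+1) : Prop :=
  (forall j : 'I_n.+2, (j <= i)%N -> (s.1 j = j :> nat) /\ s.2 j = ord0) /\
  (forall j : 'I_n.+2, (i < j)%N -> (s.1 j = j.-1 :> nat) /\ s.2 j = ord_max).

Lemma shuffle_simplex n i : (i <= n)%N ->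
  exists s : sprod (simplex n) interval n.+1, shuffle i s.
Proof.
move=> ni.
have bd (j : 'I_n.+2) : ((if j <= i then j : nat else j.-1) < n.+1)%N.
  by case: ifP; have := ltn_ord j; lia.
have [a ha] : exists a : dmap n.+1 n, a =1 fun j => Ordinal (bd j).
  by apply: dmk_nat => x y /=; case: ifP; case: ifP; lia.
have [t ht] : exists t : dmap n.+1 1,
    t =1 fun j : 'I_n.+2 => if (j <= i)%N then ord0 else ord_max.
  by apply: dmk_nat => x y /=; case: ifP; case: ifP => //=; lia.
exists (a, t); split=> j ji; rewrite /= ha ht /= ?ji //.
by rewrite leqNgt ji.
Qed.

(** A simplex of stage [i] outside stage [i.+1] passes through the vertex (i,1), which confines it
    to the shuffle. *)
Lemma prism_shuffle n i m (y : sprod (simplex n) interval m)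
    (s : sprod (simplex n) interval n.+1) :
  (i <= n)%N -> shuffle i s ->
  prism_stage i y <->
  prism_stage i.+1 y \/
  exists u, y = @yoneda (sprod (simplex n) interval) _ s m u.
Proof.
move=> ni [s0 s1]; split; last first.
  case=> [[h|h]|[u ->]]; [by left|by right=> j /h /ltnW|right=> j /=].
  have [ji|ij] := leqP (u j) i; first by rewrite (s0 _ ji).2.
  by rewrite (s1 _ ij).1 => _; lia.
case=> [h|h]; first by left; left.
have [st|nst] := pselect (prism_stage i.+1 y); [by left|right].
have [j0 [tj0 xj0]] : exists j, y.2 j <> ord0 /\ (y.1 j = i :> nat).
  apply: contrapT => hn; apply: nst; right => j tj.
  rewrite ltn_neqAle h // andbT; apply/eqP => e; apply: hn; exists j; split=> //.
have lt0 j : y.2 j = ord0 -> (y.1 j <= i)%N.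
  move=> tj; rewrite -xj0; apply: dmap_le; rewrite leqNgt; apply/negP => /ltnW.
  move/(dmap_le y.2); rewrite tj leqn0 => /eqP e; apply: tj0; exact: val_inj.
(* The coordinates of the [j]-th vertex of the shuffle add up to [j], so their sum recovers the
   index. *)
pose g j : 'I_n.+2 := inord (y.2 j + y.1 j).
have gE j : g j = (y.2 j + y.1 j)%N :> nat.
  by rewrite inordK //; have := ltn_ord (y.2 j); have := ltn_ord (y.1 j); lia.
have [|u hu] := @dmk_nat m n.+1 g.
  by move=> a b ab; rewrite !gE leq_add ?dmap_le.
have uE j : (u j : nat) = (y.2 j + y.1 j)%N by rewrite hu gE.
exists u; rewrite [y]surjective_pairing /=; congr pair; apply: dmap_ext => j /=.
  apply: val_inj => /=; have [e|e] := ord2_cases (y.2 j).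
    have ui : (u j <= i)%N by rewrite uE e; apply: lt0.
    by rewrite (s0 _ ui).1 uE e.
  have ui : (i < u j)%N by rewrite uE e ltnS; apply: h; rewrite e.
  by rewrite (s1 _ ui).1 uE e.
have [e|e] := ord2_cases (y.2 j).
  have ui : (u j <= i)%N by rewrite uE e; apply: lt0.
  by rewrite (s0 _ ui).2.
have ui : (i < u j)%N by rewrite uE e ltnS; apply: h; rewrite e.
by rewrite (s1 _ ui).2.
Qed.

(** Omitting the vertex [i.+1] removes (i,1) and lands in the next stage; omitting another vertex
    [w <> i] makes the first coordinate miss a value. The face opposite [i] does neither. *)
Lemma shuffle_horn n i m (u : simplex n.+1 m)
    (s : sprod (simplex n) interval n.+1) (hi : (i < n.+2)%N) :
  (i <= n)%N -> shuffle i s ->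
  prism_stage i.+1 (@yoneda (sprod (simplex n) interval) _ s m u) <->
  in_horn (Ordinal hi) u.
Proof.
move=> ni [s0 s1]; split.
  case=> [[v hv]|h].
    (* This index differs from [i], and the shuffle has first coordinate [v] there. *)
    exists (lift (Ordinal hi) v) => [e|j e].
      by have := neq_lift (Ordinal hi) v; rewrite e eqxx.
    apply: (hv j); apply: val_inj => /=; rewrite e.
    have [ji|ij] := leqP (lift (Ordinal hi) v) i.
      by rewrite (s0 _ ji).1; move: ji; rewrite /= /bump; case: leqP => //=; lia.
    by rewrite (s1 _ ij).1; move: ij; rewrite /= /bump; case: leqP => //=; lia.
  have hi1 : (i.+1 < n.+2)%N by [].
  exists (Ordinal hi1) => [[]|j e]; first by lia.
  have ij : (i < u j)%N by rewrite e.
  have := h j; rewrite /= (s1 _ ij).2 (s1 _ ij).1 e /= => hj.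
  by have /hj : ord_max <> ord0 :> 'I_2 by []; rewrite ltnn.
case=> w wi hw.
have wi' : (w <> i :> nat) by move=> e; apply: wi; apply: val_inj.
have [e|wi1] := eqVneq (w : nat) i.+1.
  right=> j /=; have [ji|ij] := leqP (u j) i; first by rewrite (s0 _ ji).2.
  rewrite (s1 _ ij).1 => _; have : u j <> w :> nat by move/val_inj/hw.
  by rewrite e; lia.
left; exists (s.1 w) => j /= /(congr1 val) /=.
have ne : u j <> w :> nat by move/val_inj/hw.
have [ji|ij] := leqP (u j) i; [rewrite (s0 _ ji).1|rewrite (s1 _ ij).1];
  (have [wi2|iw] := leqP w i; [rewrite (s0 _ wi2).1|rewrite (s1 _ iw).1]); lia.
Qed.

Lemma shuffle_mono n i (s : sprod (simplex n) interval n.+1) :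
  (i <= n)%N -> shuffle i s ->
  smono (@yoneda (sprod (simplex n) interval) n.+1 s).
Proof.
move=> ni [s0 s1] m u v e; apply: dmap_ext => j; apply: val_inj => /=.
have /(congr1 val) e1 := congr1 (fun p => (p.1 : dmap m n) j) e.
have e2 := congr1 (fun p => (p.2 : dmap m 1) j) e.
move: e1 e2 => /=; have [ji|ij] := leqP (u j) i;
  (have [wi2|iw] := leqP (v j) i).
- by rewrite (s0 _ ji).1 (s0 _ wi2).1.
- by rewrite (s0 _ ji).2 (s1 _ iw).2.
- by rewrite (s1 _ ij).2 (s0 _ wi2).2.
- by rewrite (s1 _ ij).1 (s1 _ iw).1; lia.
Qed.

(** The shuffles are attached for [i] from [n] down to 0, each along one horn; [d] counts those
    already attached. *)
Lemma prism_fill n (K : sset) G : kan K ->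
  @partial_map (sprod (simplex n) interval) K G ->
  (forall m y,
    @dom (sprod (simplex n) interval) K G m y <-> prism_stage n.+1 y) ->
  exists g : smap (sprod (simplex n) interval) K,
    forall m y k, G m y k -> g m y = k.
Proof.
move=> hK hG hdom.
suff st d : (d <= n.+1)%N -> exists G',
    [/\ @partial_map (sprod (simplex n) interval) K G',
    forall m y z, G m y z -> G' m y z &
    forall m y, @dom (sprod (simplex n) interval) K G' m y <->
      prism_stage (n.+1 - d) y].
  have [G' [hG' sub dom']] := st _ (leqnn _).
  rewrite subnn in dom'.
  have [|g hg] := total_partial_map hG'; first by move=> m y; apply/dom'; right.
  by exists g => m y k /sub Gk; apply: hG'.1 (hg _ _) Gk.
elim: d => [|d IH] dn; first by exists G; rewrite subn0; split.
have [G' [hG' sub dom']] := IH (ltnW dn).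
have ni : (n.+1 - d.+1 <= n)%N by lia.
have hi : (n.+1 - d.+1 < n.+2)%N by lia.
have [s hs] := shuffle_simplex ni.
have eqi : (n.+1 - d = (n.+1 - d.+1).+1)%N by lia.
rewrite eqi in dom'.
have [|G2 [hG2 sub2 dom2]] :=
  attach_horn (k := Ordinal hi) hK hG' (shuffle_mono ni hs).
  by move=> m u; rewrite dom'; apply: shuffle_horn.
exists G2; split=> [//|m y z /sub/sub2 //|m y].
by rewrite dom2 dom' -(prism_shuffle _ ni hs).
Qed.

(** * Homotopy extension for Kan complexes *)

Program Definition spath (K : sset) : sset :=
  @SSet (fun n => smap (sprod (simplex n) interval) K)
    (fun _ _ f g => scomp g (sprod_map (simplex_map f) (sid interval))) _ _.
Next Obligation. by apply: smap_ext => k [u t] /=; rewrite dcomp1f. Qed.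
Next Obligation. by apply: smap_ext => k [u t] /=; rewrite dcompA. Qed.

(** Together with [suntransp], the exponential law: as a map to the path complex, a homotopy can be
    extended one simplex of [X] at a time. *)
Program Definition stransp (X K : sset) (H : smap (sprod X interval) K) :
  smap X (spath K) :=
  @SMap X (spath K)
    (fun n x => scomp H (sprod_map (yoneda x) (sid interval))) _.
Next Obligation. by apply: smap_ext => k [u t] /=; rewrite sactM. Qed.

Program Definition suntransp (X K : sset) (h : smap X (spath K)) :
  smap (sprod X interval) K :=
  @SMap (sprod X interval) K (fun n x => h n x.1 n (did n, x.2)) _.
Next Obligation.
by rewrite snat /= -snat /= dcomp1f dcompf1.
Qed.

Lemma dcomp_const m n p (i : 'I_p.+1) (f : dmap m n) :
  dcomp (dconst n i) f = dconst m i.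
Proof. exact: dmap_ext. Qed.

Lemma dconst_ord0 n (t : dmap n 1) : (forall j, t j = ord0) -> t = dconst n ord0.
Proof. by move=> h; apply: dmap_ext. Qed.

(** Take a maximal partial map from [B] to the path complex with starting points given by [b]. At a
    simplex of least dimension outside its domain, the homotopy on the boundary and [b] at the start
    form an open box, whose filling would enlarge the domain. *)
Lemma kan_hep0 (K A B : sset) (i : smap A B) (b : smap B K)
    (H : smap (sprod A interval) K) : kan K -> smono i ->
  (forall n a, H n (a, dconst n (ord0 : 'I_2)) = b n (i n a)) ->
  exists G : smap (sprod B interval) K,
    (forall n x, G n (x, dconst n (ord0 : 'I_2)) = b n x) /\
    (forall n a t, G n (i n a, t) = H n (a, t)).
Proof.
move=> hK imono Hb.
pose G0 n (y : B n) (g : spath K n) := exists2 a, y = i n a & g = stransp H n a.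
pose ok n (y : B n) (g : spath K n) :=
  forall m (u : dmap m n), g m (u, dconst m ord0) = b m (sact u y).
have [|n y g [a -> ->] m u|G [hG sub okG maxG]] :=
  @maximal_partial_map B (spath K) G0 ok.
- split=> [n y g g' [a -> ->] [a' /imono <- ->] //|m n f y g [a -> ->]].
  by exists (sact f a); rewrite snat.
- by rewrite /= Hb snat.
suff tot : forall n (y : B n), dom G y.
  have [h hh] := total_partial_map hG tot.
  exists (suntransp h); split=> [n x|n a t] /=.
    by rewrite (okG _ _ _ (hh _ _)) sact1.
  have -> : h n (i n a) = stransp H n a.
    by apply: hG.1 (hh _ _) _; apply: sub; exists a.
  by rewrite /= sact1.
elim/ltn_ind => n IH x; apply: contrapT => xG.
have face m (u : dmap m n) : misses u -> dom G (sact u x).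
  move=> /misses_factor[k [d [w [kn ->]]]]; rewrite sactM.
  by apply: dom_act => //; apply: IH.
(* If [u] hit every vertex, a section of it would recover [x] from [sact u x]. *)
have onto m (u : dmap m n) : dom G (sact u x) -> misses u.
  move=> ux; apply: contrapT => /(dmap_section ord0)[d [ud _]].
  by apply: xG; rewrite -[x]sact1 -ud sactM; apply: dom_act.
(* The data on the open box: the homotopy already chosen over the boundary, and [b] at the end
   [ord0]. *)
pose C m (y : sprod (simplex n) interval m) k :=
  (misses y.1 /\ exists2 g, G m (sact y.1 x) g & k = g m (did m, y.2)) \/
  (y.2 = dconst m ord0 /\ k = b m (sact y.1 x)).
have [||g gC] := @prism_fill n K C hK.
- split=> [m [u t] k k' /=|m p f [u t] k /=].
    move=> [[_ [g Gg ->]]|[/= -> ->]] [[_ [g' Gg' ->]]|[/= e' ->]] //.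
    + by rewrite (hG.1 _ _ _ _ Gg Gg').
    + by rewrite /= e' (okG _ _ _ Gg) sact1.
    + by rewrite (okG _ _ _ Gg') sact1.
  move=> [[mu [g Gg ->]]|[/= -> ->]]; [left; split|right].
  - exact: misses_comp.
  - exists (sact f g); first by rewrite sactM; apply: hG.2.
    by rewrite -snat /= dcomp1f dcompf1.
  - by split; [exact: dcomp_const|rewrite -snat -sactM].
- move=> m [u t]; split=> [[k [[mu _]|[/= -> _]]]|[/= mu|h]];
    [by left|by right=> j|..].
    have [g Gg] := face _ _ mu.
    by exists (g m (did m, t)); left; split=> //; exists g.
  exists (b m (sact u x)); right; split=> //=; apply: dconst_ord0 => j.
  apply: contrapT => /h /=; have := ltn_ord (u j).
  by rewrite ltnS leqNgt => /negP.
have gE m (u : dmap m n) :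
    dom G (sact u x) -> G m (sact u x) (sact u (g : spath K n)).
  move=> ux; have mu := onto _ _ ux; have [g1 G1] := ux.
  suff -> : sact u (g : spath K n) = g1 by [].
  apply: smap_ext => p [v t] /=; apply: gC; left; split.
    exact: misses_comp.
  exists (sact v g1); first by rewrite sactM; apply: hG.2.
  by rewrite /= dcompf1.
apply: xG; exists (g : spath K n).
apply: (maxG (fun m y k => G m y k \/
  exists2 u, y = yoneda x m u & k = yoneda (g : spath K n) m u)).
(* Every [sact v x] with [misses v] lies in the domain and [x] does not, so [x] is nondegenerate and
   its cell is injective off the domain. *)
- apply: attach_simplex => // m u u' nd; apply: eilenberg_zilber => [v mv e|mu].
    by apply: nd; apply: dom_act => //; rewrite -e; apply: face.
  by apply: nd; apply: face.
- by left.
- move=> m y k [/okG //|[u -> ->]] p v /=; apply: gC; right.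
  by rewrite /= sactM.
by right; exists (did n); rewrite [RHS]sact1.
Qed.

(** * Reversal of simplices *)

Lemma drev_homo m n (f : dmap m n) :
  {homo (fun j => rev_ord (f (rev_ord j))) : x y / (x <= y)%O}.
Proof.
move=> x y; rewrite !leEord => xy /=.
by rewrite leq_sub2l // ltnS dmap_le //= leq_sub2l.
Qed.

Definition drev m n (f : dmap m n) : dmap m n := dmk (drev_homo f).

Lemma drevK m n : involutive (@drev m n).
Proof. by move=> f; apply: dmap_ext => j /=; rewrite !rev_ordK. Qed.

Lemma drev_comp m n p (g : dmap n p) (f : dmap m n) :
  drev (dcomp g f) = dcomp (drev g) (drev f).
Proof. by apply: dmap_ext => j /=; rewrite rev_ordK. Qed.

Lemma drev_id n : drev (did n) = did n.
Proof. by apply: dmap_ext => j /=; rewrite rev_ordK. Qed.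

Lemma drev_const m n (i : 'I_n.+1) : drev (dconst m i) = dconst m (rev_ord i).
Proof. exact: dmap_ext. Qed.

Program Definition sop (X : sset) : sset :=
  @SSet X (fun _ _ f => sact (drev f)) _ _.
Next Obligation. by rewrite drev_id sact1. Qed.
Next Obligation. by rewrite drev_comp sactM. Qed.

Definition sop_map (X Y : sset) (f : smap X Y) : smap (sop X) (sop Y) :=
  @SMap (sop X) (sop Y) f (fun _ _ u => snat f (drev u)).

Lemma kan_sop (K : sset) : kan K -> kan (sop K).
Proof.
move=> hK n k h.
have rev_horn m (u : simplex n.+1 m) (l : 'I_n.+2) :
    in_horn l u -> in_horn (rev_ord l) (drev u : simplex n.+1 m).
  case=> i il ui; exists (rev_ord i) => [/rev_ord_inj //|j /= /rev_ord_inj].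
  exact: ui.
(* Reversal lands in the horn at [rev_ord (rev_ord k)], whose index is transported to [k]. *)
pose h2 m (u : horn (rev_ord k) m) : K m :=
  h m (exist _ (drev (sval u))
    (eq_ind _ (fun l => in_horn l _) (rev_horn _ _ _ (proj2_sig u)) _ (rev_ordK k))).
have nat2 m p (f : dmap m p) (u : horn (rev_ord k) p) :
    h2 m (sact f u) = sact f (h2 p u).
  rewrite -[f in RHS]drevK -[RHS](snat h (drev f)) /h2; congr (h m _).
  by apply: eq_exist; rewrite /= drev_comp.
have [g hg] := hK _ _ (SMap nat2).
have natg m p (f : dmap m p) (u : simplex n.+1 p) :
    g m (drev (sact f u)) = sact (drev f) (g p (drev u)).
  by rewrite -snat /= drev_comp.
exists (@SMap (simplex n.+1) (sop K) (fun m u => g m (drev u)) natg).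
apply: smap_ext => m u /=.
have hu := rev_horn _ _ _ (proj2_sig u).
rewrite -[LHS]/(scomp g (horn_incl (rev_ord k)) m
  (exist _ (drev (sval u)) hu)) hg /= /h2.
by congr (h m _); case: u hu => u ? ?; apply: eq_exist; rewrite /= drevK.
Qed.

Program Definition sprod_drev (X K : sset)
  (H : smap (sprod (sop X) interval) (sop K)) :
  smap (sprod X interval) K :=
  @SMap (sprod X interval) K (fun n x => H n (x.1, drev x.2)) _.
Next Obligation.
by rewrite -[f in RHS]drevK -[RHS](snat H (drev f)) /= drevK drev_comp.
Qed.

Program Definition sop_drev (X K : sset) (H : smap (sprod X interval) K) :
  smap (sprod (sop X) interval) (sop K) :=
  @SMap (sprod (sop X) interval) (sop K) (fun n x => H n (x.1, drev x.2)) _.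
Next Obligation. by rewrite -snat /= drev_comp. Qed.

(** Passing to opposite simplicial sets exchanges the ends of the interval, which reduces [ord_max]
    to [ord0]. *)
Lemma kan_hep (e : 'I_2) (K A B : sset) (i : smap A B) (b : smap B K)
    (H : smap (sprod A interval) K) : kan K -> smono i ->
  (forall n a, H n (a, dconst n e) = b n (i n a)) ->
  exists G : smap (sprod B interval) K,
    (forall n x, G n (x, dconst n e) = b n x) /\
    (forall n a t, G n (i n a, t) = H n (a, t)).
Proof.
move=> hK imono.
have [->|->] := ord2_cases e; first exact: kan_hep0.
have r0 n : drev (dconst n ord_max) = dconst n (ord0 : 'I_2).
  by rewrite drev_const; congr dconst; apply: val_inj.
have r1 n : drev (dconst n ord0) = dconst n (ord_max : 'I_2).
  by rewrite -r0 drevK.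
move=> Hb; have [|n a|G [Gb GH]] := @kan_hep0 (sop K) (sop A) (sop B) (sop_map i)
  (sop_map b) (sop_drev H) (kan_sop hK).
- exact: imono.
- by rewrite /= r1 Hb.
exists (sprod_drev G); split=> [n x|n a t] /=; first by rewrite r0 Gb.
by rewrite GH /= drevK.
Qed.

(** * Strong homotopy equivalences and dependent products *)

Lemma rev_ord2 : rev_ord (ord0 : 'I_2) = ord_max /\ rev_ord (ord_max : 'I_2) = ord0.
Proof. by split; apply: val_inj. Qed.

Lemma homotopic_refl (X Y : sset) (f : smap X Y) : homotopic f f.
Proof. exact: rst_refl. Qed.

Lemma homotopic_sym (X Y : sset) (f g : smap X Y) :
  homotopic f g -> homotopic g f.
Proof. exact: rst_sym. Qed.

Lemma homotopic_trans (X Y : sset) (g f h : smap X Y) :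
  homotopic f g -> homotopic g h -> homotopic f h.
Proof. exact: rst_trans. Qed.

Lemma homotopic_ends (e : 'I_2) (X Y : sset) (H : smap (sprod X interval) Y)
    (f g : smap X Y) :
  (forall n x, H n (x, dconst n e) = f n x) ->
  (forall n x, H n (x, dconst n (rev_ord e)) = g n x) -> homotopic f g.
Proof.
have [r0 r1] := rev_ord2.
have [->|->] := ord2_cases e => Hf; rewrite ?r0 ?r1 => Hg.
  by apply: rst_step; exists H.
by apply: rst_sym; apply: rst_step; exists H.
Qed.

Lemma homotopic_comp (W X Y Z : sset) (f g : smap X Y) (k : smap Y Z)
    (h : smap W X) :
  homotopic f g -> homotopic (scomp (scomp k f) h) (scomp (scomp k g) h).
Proof.
elim=> {f g} [f g [H [H0 H1]]|f|f g _|f g l _ IH1 _ IH2].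
- apply: (@homotopic_ends ord0 _ _ (scomp k (scomp H (sprod_map h (sid _))))).
    by move=> n x /=; rewrite H0.
  by move=> n x /=; rewrite rev_ord2.1 H1.
- exact: homotopic_refl.
- exact: homotopic_sym.
- exact: homotopic_trans IH1 IH2.
Qed.

Lemma homotopic_compl (X Y Z : sset) (f g : smap X Y) (k : smap Y Z) :
  homotopic f g -> homotopic (scomp k f) (scomp k g).
Proof.
move=> /(homotopic_comp k (sid X)).
have id h : scomp (scomp k h) (sid X) = scomp k h by apply: smap_ext.
by rewrite !id.
Qed.

Lemma homotopic_compr (W X Y : sset) (f g : smap X Y) (h : smap W X) :
  homotopic f g -> homotopic (scomp f h) (scomp g h).
Proof.
move=> /(homotopic_comp (sid Y) h).
have id k : scomp (scomp (sid Y) k) h = scomp k h by apply: smap_ext.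
by rewrite !id.
Qed.

Lemma scompA (W X Y Z : sset) (f : smap Y Z) (g : smap X Y) (h : smap W X) :
  scomp f (scomp g h) = scomp (scomp f g) h.
Proof. exact: smap_ext. Qed.

Lemma scomp1 (X Y : sset) (f : smap X Y) : scomp f (sid X) = f.
Proof. exact: smap_ext. Qed.

(* In the arrow category, [i] is a retract of the inclusion of the open box
   [A * Delta^1 U B * {e}] into [B * Delta^1]. *)
Definition strong_equiv (e : 'I_2) (A B : sset) (i : smap A B) : Prop :=
  exists (g : smap B A) (hA : smap (sprod A interval) A)
    (hB : smap (sprod B interval) B),
  [/\ forall n a, hA n (a, dconst n e) = g n (i n a),
      forall n a, hA n (a, dconst n (rev_ord e)) = a,
      forall n b, hB n (b, dconst n e) = i n (g n b),
      forall n b, hB n (b, dconst n (rev_ord e)) = b &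
      forall n a t, i n (hA n (a, t)) = hB n (i n a, t)].

Lemma homotopy_equiv_weq (A B : sset) (i : smap A B) (g : smap B A) :
  homotopic (scomp g i) (sid A) -> homotopic (scomp i g) (sid B) -> weq i.
Proof.
move=> gi ig K _; split=> [f h fh|f].
  have hom (k : smap B K) : homotopic k (scomp (scomp k i) g).
    rewrite -scompA -[X in homotopic X _]scomp1.
    exact/homotopic_compl/homotopic_sym.
  apply: (homotopic_trans (hom f)).
  apply: (homotopic_trans _ (homotopic_sym (hom h))).
  exact: homotopic_compr.
exists (scomp f g); rewrite -scompA -[X in homotopic _ X]scomp1.
exact: homotopic_compl.
Qed.

Lemma strong_equiv_weq e (A B : sset) (i : smap A B) : strong_equiv e i -> weq i.
Proof.
move=> [g [hA [hB [A0 A1 B0 B1 _]]]]; apply: (@homotopy_equiv_weq _ _ _ g).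
  exact: (@homotopic_ends e _ _ hA).
exact: (@homotopic_ends e _ _ hB).
Qed.

Program Definition at_end (e : 'I_2) (X Y : sset)
  (H : smap (sprod X interval) Y) : smap X Y :=
  @SMap X Y (fun n x => H n (x, dconst n e)) _.
Next Obligation. by rewrite -snat /= dcomp_const. Qed.

(** The homotopy [scomp a hA] joins the restriction of [scomp a g] to [a]. Homotopy extension
    spreads it over [B], and its far end extends [a]. *)
Lemma strong_equiv_extend e (A B K : sset) (i : smap A B) (a : smap A K) :
  kan K -> smono i -> strong_equiv e i -> exists b : smap B K, scomp b i = a.
Proof.
move=> hK imono [g [hA [hB [A0 A1 B0 B1 AB]]]].
have [|G [_ GA]] := @kan_hep e K A B i (scomp a g) (scomp a hA) hK imono.
  by move=> n x; rewrite /= A0.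
exists (at_end (rev_ord e) G); apply: smap_ext => n x /=.
by rewrite GA /= A1.
Qed.

(** * Pullbacks and homotopy lifting *)

Lemma spull_act_subproof (A P M : sset) (f : smap A M) (p : smap P M) m n
    (u : dmap m n) (x : {x : A n * P n | f n x.1 = p n x.2}) :
  f m (sact u (sval x).1) = p m (sact u (sval x).2).
Proof. by rewrite !snat (svalP x). Qed.

Program Definition spull (A P M : sset) (f : smap A M) (p : smap P M) : sset :=
  @SSet (fun n => {x : A n * P n | f n x.1 = p n x.2})
    (fun m n u x => exist _ (_, _) (spull_act_subproof u x)) _ _.
Next Obligation. by apply: eq_exist; rewrite /= !sact1. Qed.
Next Obligation. by apply: eq_exist; rewrite /= !sactM. Qed.

Definition spull_fst (A P M : sset) (f : smap A M) (p : smap P M) :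
  smap (spull f p) A :=
  @SMap (spull f p) A (fun n x => (sval x).1) (fun _ _ _ _ => erefl).

Definition spull_snd (A P M : sset) (f : smap A M) (p : smap P M) :
  smap (spull f p) P :=
  @SMap (spull f p) P (fun n x => (sval x).2) (fun _ _ _ _ => erefl).

Program Definition spull_pair (W A P M : sset) (f : smap A M) (p : smap P M)
  (a : smap W A) (y : smap W P) (e : scomp f a = scomp p y) :
  smap W (spull f p) :=
  @SMap W (spull f p) (fun n w =>
    exist _ (a n w, y n w) (congr1 (fun h : smap W M => h n w) e)) _.
Next Obligation. by apply: eq_exist; rewrite /= !snat. Qed.

Lemma spull_ext (A P M : sset) (f : smap A M) (p : smap P M) n
  (x y : spull f p n) : (sval x).1 = (sval y).1 -> (sval x).2 = (sval y).2 -> x = y.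
Proof.
by case: x y => [[a b] e] [[a' b'] e'] /= ea eb; apply: eq_exist; rewrite ea eb.
Qed.

Lemma spull_comm (A P M : sset) (f : smap A M) (p : smap P M) :
  scomp f (spull_fst f p) = scomp p (spull_snd f p).
Proof. by apply: smap_ext => n [x e]. Qed.

Definition homotopy_lifting (P M : sset) (p : smap P M) : Prop :=
  forall (e : 'I_2) (W : sset) (H : smap (sprod W interval) M) (v : smap W P),
  (forall n w, H n (w, dconst n e) = p n (v n w)) ->
  exists G : smap (sprod W interval) P, scomp p G = H /\
    (forall n w, G n (w, dconst n e) = v n w).

Lemma spull_mono_eq (A B P M : sset) (f : smap B M) (p : smap P M) (i : smap A B) :
  scomp f (scomp i (spull_fst (scomp f i) p)) = scomp p (spull_snd (scomp f i) p).
Proof. by rewrite scompA spull_comm. Qed.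

Definition spull_map (A B P M : sset) (f : smap B M) (p : smap P M) (i : smap A B) :
  smap (spull (scomp f i) p) (spull f p) := spull_pair (spull_mono_eq f p i).

Lemma spull_map_mono (A B P M : sset) (f : smap B M) (p : smap P M) (i : smap A B) :
  smono i -> smono (spull_map f p i).
Proof.
move=> hi n [[a x] e] [[a' x'] e'] [/hi/= ea ex].
by apply: (@spull_ext _ _ _ (scomp f i) p).
Qed.

(** The deformation [hB] is lifted from the end where it is the identity. The other end of the lift
    gives the retraction, and its restriction along [i] lies over [hA]. *)
Lemma strong_equiv_pull e (A B P M : sset) (f : smap B M) (p : smap P M)
    (i : smap A B) : homotopy_lifting p -> strong_equiv e i ->
  strong_equiv e (spull_map f p i).
Proof.
move=> hp [g [hA [hB [A0 A1 B0 B1 AB]]]].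
pose W := spull f p.
have [|G [pG G1]] := hp (rev_ord e) W
    (scomp f (scomp hB (sprod_map (spull_fst f p) (sid _)))) (spull_snd f p).
  by move=> n w /=; rewrite B1 (svalP w).
have {}pG n w t : f n (hB n ((sval w).1, t)) = p n (G n (w, t)).
  exact: esym (congr1 (fun h : smap (sprod W interval) M => h n (w, t)) pG).
have eg : scomp (scomp f i) (scomp g (spull_fst f p)) = scomp p (at_end e G).
  by apply: smap_ext => n w /=; rewrite -B0 pG.
have eA : scomp (scomp f i) (scomp hA (sprod_map (spull_fst (scomp f i) p) (sid _))) =
    scomp p (scomp G (sprod_map (spull_map f p i) (sid _))).
  by apply: smap_ext => n [w t] /=; rewrite AB -pG.
have eB : scomp f (scomp hB (sprod_map (spull_fst f p) (sid _))) = scomp p G.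
  by apply: smap_ext => n [w t] /=; rewrite pG.
exists (spull_pair eg), (spull_pair eA), (spull_pair eB); split.
- by move=> n a; apply: spull_ext => //=; rewrite A0.
- by move=> n a; apply: spull_ext => //=; rewrite ?A1 ?G1.
- by move=> n b; apply: spull_ext => //=; rewrite B0.
- by move=> n b; apply: spull_ext => //=; rewrite ?B1 ?G1.
- by move=> n a t; apply: spull_ext => //=; rewrite AB.
Qed.

(* The simplices of the dependent product along [p] of the constant family
   [K]: a simplex of [M] with a map from the pullback of [p] along it to [K]. *)
Record fibhom_simplex (P M K : sset) (p : smap P M) n := FibhomSimplex {
  fibhom_base : M n;
  fibhom_fun : forall k (u : dmap k n) (y : P k), sact u fibhom_base = p k y -> K k;
  fibhom_nat : forall k l (v : dmap l k) (u : dmap k n) (y : P k) e e',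
    @fibhom_fun l (dcomp u v) (sact v y) e' = sact v (@fibhom_fun k u y e) }.

Lemma fibhom_ext (P M K : sset) (p : smap P M) n (x y : fibhom_simplex K p n) :
  fibhom_base x = fibhom_base y ->
  (forall k (u : dmap k n) z e e',
    @fibhom_fun _ _ _ _ _ x k u z e = @fibhom_fun _ _ _ _ _ y k u z e') -> x = y.
Proof.
case: x y => [m f hf] [m' f' hf'] /= em; subst m' => ef.
have {}ef : f = f'.
  do 4!(apply: functional_extensionality_dep => ?); exact: ef.
by subst f'; rewrite (Prop_irrelevance hf hf').
Qed.

Lemma fibhom_fun_eq (P M K : sset) (p : smap P M) n (x : fibhom_simplex K p n) k
    (u u' : dmap k n) y y' e e' : u = u' -> y = y' ->
  @fibhom_fun _ _ _ _ _ x k u y e = @fibhom_fun _ _ _ _ _ x k u' y' e'.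
Proof. by move=> hu hy; subst u' y'; rewrite (Prop_irrelevance e e'). Qed.

Program Definition fibhom_act (P M K : sset) (p : smap P M) m n (f : dmap m n)
  (x : fibhom_simplex K p n) : fibhom_simplex K p m :=
  @FibhomSimplex P M K p m (sact f (fibhom_base x))
    (fun k u y e => @fibhom_fun _ _ _ _ _ x k (dcomp f u) y (etrans (sactM f u _) e)) _.
Next Obligation.
have e2 : sact (dcomp (dcomp f u) v) (fibhom_base x) = p l (sact v y).
  by rewrite -dcompA sactM e'.
rewrite -(fibhom_nat _ e2); apply: fibhom_fun_eq => //; exact: dcompA.
Qed.

Program Definition fibhom (P M K : sset) (p : smap P M) : sset :=
  @SSet (fibhom_simplex K p) (@fibhom_act P M K p) _ _.
Next Obligation.
apply: fibhom_ext => [|k u z e e'] /=; first exact: sact1.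
by apply: fibhom_fun_eq => //; apply: dcomp1f.
Qed.
Next Obligation.
apply: fibhom_ext => [|k u z e e'] /=; first exact: sactM.
by apply: fibhom_fun_eq => //; rewrite dcompA.
Qed.

Definition fibhom_proj (P M K : sset) (p : smap P M) : smap (fibhom K p) M :=
  @SMap (fibhom K p) M (fun n x => fibhom_base x) (fun _ _ _ _ => erefl).

Lemma sact_did_eq (M P : sset) (p : smap P M) n (x : M n) (y : P n) :
  x = p n y -> sact (did n) x = p n y.
Proof. by rewrite sact1. Qed.

Definition fibhom_eval_fun (P M K : sset) (p : smap P M) n
  (x : spull (fibhom_proj K p) p n) : K n :=
  @fibhom_fun _ _ _ _ _ (sval x).1 n (did n) (sval x).2 (sact_did_eq (svalP x)).

Lemma fibhom_eval_nat (P M K : sset) (p : smap P M) m n (f : dmap m n)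
    (x : spull (fibhom_proj K p) p n) :
  fibhom_eval_fun (sact f x) = sact f (fibhom_eval_fun x).
Proof.
have e' : sact (dcomp (did n) f) (fibhom_base (sval x).1) = p m (sact f (sval x).2).
  by rewrite dcomp1f snat -(svalP x).
rewrite /fibhom_eval_fun -(fibhom_nat _ e') /=; apply: fibhom_fun_eq => //.
by rewrite dcomp1f dcompf1.
Qed.

Definition fibhom_eval (P M K : sset) (p : smap P M) :
  smap (spull (fibhom_proj K p) p) K := SMap (@fibhom_eval_nat P M K p).

Lemma spull_act_eq (A P M : sset) (f : smap A M) (p : smap P M) k n (u : dmap k n)
  (a : A n) (y : P k) : sact u (f n a) = p k y -> f k (sact u a) = p k y.
Proof. by rewrite snat. Qed.

(** The transpose of [h] under the adjunction between pulling back along [p] and [fibhom], whose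
    counit is [fibhom_eval]. *)
Program Definition fibhom_curry (A P M K : sset) (f : smap A M) (p : smap P M)
  (h : smap (spull f p) K) : smap A (fibhom K p) :=
  @SMap A (fibhom K p) (fun n a => @FibhomSimplex P M K p n (f n a)
    (fun k u y e => h k (exist _ (sact u a, y) (spull_act_eq e))) _) _.
Next Obligation.
by rewrite -snat; congr (h l _); apply: spull_ext => //=; rewrite sactM.
Qed.
Next Obligation.
apply: fibhom_ext => [|k u z e e'] /=; first exact: snat.
by congr (h k _); apply: spull_ext => //=; rewrite sactM.
Qed.

Lemma fibhom_map_ext (A P M K : sset) (p : smap P M) (f g : smap A (fibhom K p)) :
  scomp (fibhom_proj K p) f = scomp (fibhom_proj K p) g ->
  (forall n (a : A n) y (e : fibhom_base (f n a) = p n y)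
     (e' : fibhom_base (g n a) = p n y),
    fibhom_eval K p n (exist _ (f n a, y) e) =
    fibhom_eval K p n (exist _ (g n a, y) e')) -> f = g.
Proof.
move=> base ev; apply: smap_ext => n a; apply: fibhom_ext => [|k u y e e'].
  exact: (congr1 (fun h : smap A M => h n a) base).
have ef : fibhom_base (f k (sact u a)) = p k y by rewrite snat.
have eg : fibhom_base (g k (sact u a)) = p k y by rewrite snat.
have := ev _ _ _ ef eg; rewrite /= /fibhom_eval_fun /=.
have Efg (h : smap A (fibhom K p)) e1 e2 :
  @fibhom_fun _ _ _ _ _ (h k (sact u a)) k (did k) y e1 =
  @fibhom_fun _ _ _ _ _ (h n a) k u y e2.
  move: e1; rewrite snat => e1 /=; apply: fibhom_fun_eq => //; exact: dcompf1.
by rewrite (Efg f _ e) (Efg g _ e').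
Qed.

(** By transposition, lifting amounts to extending a map to [K] along [spull_map f p i], which is
    again a monomorphism and a strong equivalence. *)
Lemma fibhom_lift e (A B P M K : sset) (p : smap P M) (i : smap A B)
    (a : smap A (fibhom K p)) (f : smap B M) :
  kan K -> homotopy_lifting p -> smono i -> strong_equiv e i ->
  scomp (fibhom_proj K p) a = scomp f i ->
  exists b : smap B (fibhom K p), scomp b i = a /\ scomp (fibhom_proj K p) b = f.
Proof.
move=> hK hp hi si af.
have ea : scomp (fibhom_proj K p) (scomp a (spull_fst (scomp f i) p)) =
    scomp p (spull_snd (scomp f i) p).
  by rewrite scompA af spull_comm.
have [h hh] := strong_equiv_extend (scomp (fibhom_eval K p) (spull_pair ea)) hK
  (@spull_map_mono _ _ _ _ f p _ hi) (strong_equiv_pull f hp si).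
exists (fibhom_curry h); split; last by apply: smap_ext.
apply: fibhom_map_ext => [|n x y e1 e2]; first by rewrite af; apply: smap_ext.
have e3 : f n (i n x) = p n y by [].
pose w : spull (scomp f i) p n := exist _ (x, y) e3.
transitivity (scomp h (spull_map f p i) n w).
  by rewrite /=; congr (h n _); apply: spull_ext => //=; rewrite sact1.
by rewrite hh /=; apply: fibhom_fun_eq.
Qed.

(** * Horns and path fibrations *)

(** The minimum of [v] and [k] for [e = ord0], their maximum for [e = ord_max]. *)
Definition oretract (e : 'I_2) n (k v : 'I_n.+1) : 'I_n.+1 :=
  if (if e == ord0 then (v <= k)%N else (k <= v)%N) then v else k.

Lemma oretract_id e n (k : 'I_n.+1) : oretract e k k = k.
Proof. by rewrite /oretract; case: ifP. Qed.

(** For [e = ord0] the altered positions come first and are lowered; for [e = ord_max] they come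
    last and are raised. *)
Lemma toward_homo e n (k : 'I_n.+1) m (x : dmap m n) (t : dmap m 1) :
  {homo (fun j => if t j == e then oretract e k (x j) else x j) :
    i j / (i <= j)%O}.
Proof.
move=> i j; rewrite !leEord => ij; have := dmap_le x ij; have := dmap_le t ij.
rewrite /oretract; have [->|->] := ord2_cases e;
  have [->|->] := ord2_cases (t i); have [->|->] := ord2_cases (t j) => //=;
  repeat case: ifP => //=; lia.
Qed.

(* Deforms [x] onto the vertices on the [e]-side of [k], as [t] moves to [e]. *)
Definition toward (e : 'I_2) n (k : 'I_n.+1) m (x : dmap m n) (t : dmap m 1) :
  dmap m n := dmk (toward_homo e k x t).

Lemma toward_comp e n (k : 'I_n.+1) m p (x : dmap m n) (t : dmap m 1)
    (f : dmap p m) :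
  toward e k (dcomp x f) (dcomp t f) = dcomp (toward e k x t) f.
Proof. exact: dmap_ext. Qed.

Lemma rev_ord2_neq (e : 'I_2) : (rev_ord e == e) = false.
Proof. by have [->|->] := ord2_cases e. Qed.

Lemma toward_rev e n (k : 'I_n.+1) m (x : dmap m n) :
  toward e k x (dconst m (rev_ord e)) = x.
Proof. by apply: dmap_ext => j /=; rewrite rev_ord2_neq. Qed.

Lemma toward_in_horn e n (k : 'I_n.+1) m (x : simplex n m) t :
  in_horn k x -> in_horn k (toward e k x t : simplex n m).
Proof.
case=> i ik xi; exists i => // j /=; rewrite /oretract.
by case: ifP => // _; case: ifP => // _ /esym.
Qed.

(** For [k = 0] everything collapses to vertex 0, and the last vertex is missed. Otherwise all
    vertices move to [k] or beyond, and vertex 0 is missed. *)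
Lemma toward_end_in_horn n (k : 'I_n.+2) : exists e, forall m (x : simplex n.+1 m),
  in_horn k (toward e k x (dconst m e) : simplex n.+1 m).
Proof.
have [k0|k0] := eqVneq (k : nat) 0; [exists ord0|exists ord_max] => m x.
  exists ord_max => [e|j /= e]; first by rewrite -e in k0.
  move: (congr1 val e); rewrite /oretract eqxx /=; case: ifP => /=; lia.
exists ord0 => [e|j /= e]; first by rewrite -e in k0.
move: (congr1 val e); rewrite /oretract /=; case: ifP => /=; lia.
Qed.

Program Definition toward_map e n (k : 'I_n.+1) :
  smap (sprod (simplex n) interval) (simplex n) :=
  @SMap (sprod (simplex n) interval) (simplex n)
    (fun m x => toward e k x.1 x.2) _.
Next Obligation. exact: toward_comp. Qed.

(** The homotopy [toward] sends each vertex to itself or to [k], so it preserves the horn, and at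
    the end [e] it carries the whole simplex into it. *)
Lemma horn_strong_equiv n (k : 'I_n.+2) :
  exists e, strong_equiv e (horn_incl k).
Proof.
have [e he] := toward_end_in_horn k; exists e.
pose g m (x : simplex n.+1 m) : horn k m := exist _ _ (he m x).
have gnat m p (f : dmap m p) x : g m (sact f x) = sact f (g p x).
  by apply: eq_exist; rewrite /= -toward_comp dcomp_const.
pose hA m (x : sprod (horn k) interval m) : horn k m :=
  exist _ _ (@toward_in_horn e _ k _ (sval x.1) x.2 (svalP x.1)).
have hnat m p (f : dmap m p) x : hA m (sact f x) = sact f (hA p x).
  by apply: eq_exist; rewrite /= -toward_comp.
exists (SMap gnat), (SMap hnat), (toward_map e k); split=> //=.
- by move=> m [x xk]; apply: eq_exist.
- by move=> m [x xk]; apply: eq_exist; rewrite /= toward_rev.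
- by move=> m x; rewrite toward_rev.
Qed.

Lemma horn_incl_mono n (k : 'I_n.+1) : smono (horn_incl k).
Proof. by move=> m [x xk] [y yk] /= e; apply: eq_exist. Qed.

Program Definition end_incl (e : 'I_2) (A : sset) : smap A (sprod A interval) :=
  @SMap A (sprod A interval) (fun n a => (a, dconst n e)) _.
Next Obligation. by congr pair; apply/esym/dcomp_const. Qed.

Lemma end_incl_mono e A : smono (end_incl e A).
Proof. by move=> n a b [->]. Qed.

Program Definition sfst (A B : sset) : smap (sprod A B) A :=
  @SMap (sprod A B) A (fun n x => x.1) _.

Program Definition end_deform (e : 'I_2) (A : sset) :
  smap (sprod (sprod A interval) interval) (sprod A interval) :=
  @SMap (sprod (sprod A interval) interval) (sprod A interval)
    (fun n x => (x.1.1, toward e e x.1.2 x.2)) _.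
Next Obligation. by congr pair; apply: toward_comp. Qed.

Lemma end_incl_strong_equiv e A : strong_equiv e (end_incl e A).
Proof.
exists (sfst A interval), (sfst A interval), (end_deform e A); split=> //=.
- move=> n [a s] /=; congr pair; apply: dmap_ext => j /=.
  rewrite eqxx /oretract; have [->|->] := ord2_cases e;
    by have [->|->] := ord2_cases (s j).
- by move=> n [a s] /=; rewrite toward_rev.
- move=> n a t; congr pair; apply: dmap_ext => j /=.
  by rewrite oretract_id if_same.
Qed.

Lemma fibhom_kan (P M K : sset) (p : smap P M) :
  kan M -> kan K -> homotopy_lifting p -> kan (fibhom K p).
Proof.
move=> hM hK hp n k h.
have [f hf] := hM _ _ (scomp (fibhom_proj K p) h).
have [e he] := horn_strong_equiv k.
have [b [bi _]] := fibhom_lift hK hp (@horn_incl_mono _ k) he (esym hf).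
by exists b.
Qed.

Lemma fibhom_homotopy_lifting (P M K : sset) (p : smap P M) :
  kan K -> homotopy_lifting p -> homotopy_lifting (fibhom_proj K p).
Proof.
move=> hK hp e W H v Hv.
have [|b [bi pb]] := @fibhom_lift e _ _ _ _ _ p (end_incl e W) v H hK hp
  (@end_incl_mono e W) (end_incl_strong_equiv e W).
  by apply: smap_ext => n x /=; rewrite Hv.
by exists b; split=> // n w; rewrite -bi.
Qed.

(** * The path fibration *)

Definition path_to (M : sset) (x : smap spoint M) n (g : spath M n) : Prop :=
  forall m (u : dmap m n), g m (u, dconst m ord_max) = x m tt.

Lemma path_to_act (M : sset) (x : smap spoint M) m n (f : dmap m n)
  (g : {g : spath M n | path_to x g}) : path_to x (sact f (sval g)).
Proof. by move=> p u; apply: (svalP g). Qed.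

Program Definition paths_to (M : sset) (x : smap spoint M) : sset :=
  @SSet (fun n => {g : spath M n | path_to x g})
    (fun m n f g => exist _ _ (path_to_act f g)) _ _.
Next Obligation. by apply: eq_exist; exact: (@sact1 (spath M)). Qed.
Next Obligation. by apply: eq_exist; exact: (@sactM (spath M)). Qed.

Lemma paths_to_ext (M : sset) (x : smap spoint M) n (g h : paths_to x n) :
  (forall m u s, sval g m (u, s) = sval h m (u, s)) -> g = h.
Proof.
case: g h => g hg [h hh] /= e; apply: eq_exist.
by apply: smap_ext => m [u s]; apply: e.
Qed.

Definition path_start_fun (M : sset) (x : smap spoint M) n (g : paths_to x n) :
  M n :=
  sval g n (did n, dconst n ord0).

Lemma path_start_nat (M : sset) (x : smap spoint M) m n (f : dmap m n)
  (g : paths_to x n) : path_start_fun (sact f g) = sact f (path_start_fun g).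
Proof. by rewrite /path_start_fun -snat /= dcomp1f dcompf1 dcomp_const. Qed.

Definition path_start (M : sset) (x : smap spoint M) : smap (paths_to x) M :=
  SMap (@path_start_nat M x).

Definition disc (T : Type) : sset :=
  @SSet (fun _ => T) (fun _ _ _ x => x) (fun _ _ => erefl)
    (fun _ _ _ _ _ _ => erefl).

Definition end_of (b : bool) : 'I_2 := if b then ord_max else ord0.

Program Definition ends_incl (W : sset) :
  smap (sprod W (disc bool)) (sprod W interval) :=
  @SMap (sprod W (disc bool)) (sprod W interval)
    (fun n x => (x.1, dconst n (end_of x.2))) _.
Next Obligation. by congr pair; apply/esym/dcomp_const. Qed.

Lemma ends_incl_mono (W : sset) : smono (ends_incl W).
Proof.
move=> n [w b] [w' b'] e; congr pair; first by case: e.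
have /= := congr1 (fun y : sprod W interval n => (y.2 : dmap n 1) ord0) e.
by case: b {e}; case: b'.
Qed.

(** A homotopy of paths is a map with a path parameter and a time. It is prescribed by [v] at time
    [e], by [H] at path starts and by [x] at path ends; homotopy extension along [ends_incl]
    supplies the rest. *)
Lemma path_start_homotopy_lifting (M : sset) (x : smap spoint M) :
  kan M -> homotopy_lifting (path_start x).
Proof.
move=> hM e W H v Hv.
pose HA n (y : sprod (sprod W (disc bool)) interval n) : M n :=
  if y.1.2 then x n tt else H n (y.1.1, y.2).
have HAnat m n (f : dmap m n) y : HA m (sact f y) = sact f (HA n y).
  case: y => [[w []] t]; rewrite /HA /= -snat //.
pose b n (y : sprod W interval n) : M n := sval (v n y.1) n (did n, y.2).
have bnat m n (f : dmap m n) y : b m (sact f y) = sact f (b n y).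
  by rewrite /b -[RHS]snat /= snat /= dcomp1f dcompf1.
have [|G [G0 GA]] := @kan_hep e M _ _ (ends_incl W) (SMap bnat) (SMap HAnat) hM
    (@ends_incl_mono W).
  move=> n [w []]; rewrite /= /HA /b /=; first by rewrite (svalP (v n w)).
  exact: Hv.
(* The two parameters trade places: [y] carries the time and [s] the path parameter. *)
pose K n (y : sprod W interval n) m (s : sprod (simplex n) interval m) : M m :=
  G m ((sact s.1 y.1, s.2), sact s.1 y.2).
have Knat n y m p (f : dmap m p) s : K n y m (sact f s) = sact f (K n y p s).
  by rewrite /K -snat /= sactM dcompA.
have Kend n y : path_to x (SMap (Knat n y) : spath M n).
  by move=> m u; exact: (GA m (sact u y.1, true) (sact u y.2)).
pose K' n y : paths_to x n := exist _ _ (Kend n y).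
have Knat' m n (f : dmap m n) y : K' m (sact f y) = sact f (K' n y).
  apply: paths_to_ext => p u s /=.
  by rewrite /K /= sactM dcompA.
exists (SMap Knat'); split.
  apply: smap_ext => n [w t] /=; rewrite /path_start_fun /= /K /= sact1 dcompf1.
  by rewrite -[(_, dconst _ _)]/(ends_incl W n (_, false)) GA.
move=> n w; apply: paths_to_ext => p u s /=.
by rewrite /K /= dcomp_const G0 /= /b /= snat /= dcompf1.
Qed.

Program Definition constant_path (M : sset) (x : smap spoint M) :
  smap spoint (paths_to x) :=
  @SMap spoint (paths_to x)
    (fun n _ => exist _ (@SMap _ _ (fun m _ => x m tt) _) _) _.
Next Obligation. by rewrite -snat. Qed.
Next Obligation. by []. Qed.
Next Obligation. by apply: paths_to_ext. Qed.

(** As time runs, [toward ord_max ord_max] slides the path parameter to its last value, so each path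
    shrinks to its endpoint [x]. *)
Lemma paths_to_contractible (M : sset) (x : smap spoint M) :
  homotopic (sid (paths_to x)) (scomp (constant_path x) (sterminal _)).
Proof.
pose C n (y : sprod (paths_to x) interval n) m (s : sprod (simplex n) interval m)
  : M m := sval y.1 m (s.1, toward ord_max ord_max s.2 (dcomp y.2 s.1)).
have Cnat n y m p (f : dmap m p) s : C n y m (sact f s) = sact f (C n y p s).
  by rewrite /C -snat /= dcompA toward_comp.
have Cend n y : path_to x (SMap (Cnat n y) : spath M n).
  move=> m u /=; rewrite /C /= -(svalP y.1 m u); congr (sval y.1 m (u, _)).
  by apply: dmap_ext => j /=; rewrite oretract_id if_same.
pose C' n y : paths_to x n := exist _ _ (Cend n y).
have Cnat' m n (f : dmap m n) y : C' m (sact f y) = sact f (C' n y).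
  apply: paths_to_ext => p u s /=.
  by rewrite /C /= dcompA.
apply: (@homotopic_ends ord0 _ _ (SMap Cnat')) => n g.
  apply: paths_to_ext => m u s /=; rewrite /C /=.
  congr (sval g m (u, _)); exact: dmap_ext.
apply: paths_to_ext => m u s /=; rewrite /C /= -(svalP g m u).
congr (sval g m (u, _)); apply: dmap_ext => j /=.
by rewrite /oretract; have [->|->] := ord2_cases (s j).
Qed.

(** * Acyclicity of homotopy fibres *)

(** A zigzag is lifted one elementary homotopy at a time; its backward steps make the induction
    carry both directions. *)
Lemma homotopic_lift (A P M : sset) (p : smap P M) (k k' : smap A M)
    (h : smap A P) : homotopy_lifting p -> homotopic k k' -> scomp p h = k ->
  exists h', scomp p h' = k' /\ homotopic h h'.
Proof.
move=> hp.
have step (e : 'I_2) (H : smap (sprod A interval) M) (l : smap A P) :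
    (forall n a, H n (a, dconst n e) = p n (l n a)) ->
    exists l' : smap A P,
      (forall n a, H n (a, dconst n (rev_ord e)) = p n (l' n a)) /\
      homotopic l l'.
  move=> /hp[G [<- Ge]]; exists (at_end (rev_ord e) G); split=> //.
  exact: (@homotopic_ends e _ _ G).
have [r0 r1] := rev_ord2.
suff both : homotopic k k' ->
    (forall l, scomp p l = k -> exists l', scomp p l' = k' /\ homotopic l l') /\
    (forall l, scomp p l = k' -> exists l', scomp p l' = k /\ homotopic l l').
  by move=> /both[+ _]; apply.
elim=> {k k' h} [k k' [H [H0 H1]]|k|k k' _ []|k k1 k' _ [IH IH'] _ [IH1 IH1']].
- split=> l lk.
    have [|l' [pl' ll']] := step ord0 H l; first by move=> n a; rewrite H0 -lk.
    by exists l'; split=> //; apply: smap_ext => n a; rewrite -H1 -r0 pl'.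
  have [|l' [pl' ll']] := step ord_max H l; first by move=> n a; rewrite H1 -lk.
  by exists l'; split=> //; apply: smap_ext => n a; rewrite -H0 -r1 pl'.
- by split=> l lk; exists l; split=> //; apply: homotopic_refl.
- by [].
split=> l lk.
  have [l1 [pl1 ll1]] := IH _ lk; have [l2 [pl2 ll2]] := IH1 _ pl1.
  by exists l2; split=> //; apply: homotopic_trans ll2.
have [l1 [pl1 ll1]] := IH1' _ lk; have [l2 [pl2 ll2]] := IH' _ pl1.
by exists l2; split=> //; apply: homotopic_trans ll2.
Qed.

(** Quantifying over all [v] makes the condition invariant under homotopies of [g] that move its
    projection to [M]. *)
Definition null_along (X P M K : sset) (f : smap X M) (p : smap P M)
    (g : smap X (fibhom K p)) : Prop :=
  forall (v : smap (spull f p) P)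
    (e : scomp (fibhom_proj K p) (scomp g (spull_fst f p)) = scomp p v),
  exists c : smap spoint K,
    homotopic (scomp c (sterminal _)) (scomp (fibhom_eval K p) (spull_pair e)).

(** The projected homotopy is lifted to [P] from [v]; evaluating along the lift joins the two
    evaluations. *)
Lemma null_along_homotopic (X P M K : sset) (f : smap X M) (p : smap P M)
    (g g' : smap X (fibhom K p)) : homotopy_lifting p -> homotopic g g' ->
  null_along f g -> null_along f g'.
Proof.
move=> hp.
have step (e : 'I_2) (H : smap (sprod X interval) (fibhom K p)) :
    null_along f (at_end e H) -> null_along f (at_end (rev_ord e) H).
  move=> nl v ev.
  have [|G [pG Gv]] := hp (rev_ord e) _ (scomp (fibhom_proj K p)
    (scomp H (sprod_map (spull_fst f p) (sid interval)))) v.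
    by move=> n w; exact: (congr1 (fun h : smap (spull f p) M => h n w) ev).
  have e0 : scomp (fibhom_proj K p) (scomp (at_end e H) (spull_fst f p)) =
      scomp p (at_end e G).
    apply: smap_ext => n w.
    exact: (esym (congr1 (fun h : smap (sprod (spull f p) interval) M =>
      h n (w, dconst n e)) pG)).
  have [c hc] := nl _ e0; exists c; apply: (homotopic_trans hc).
  apply: (@homotopic_ends e _ _ (scomp (fibhom_eval K p) (spull_pair (esym pG)))).
    by move=> n w; congr (fibhom_eval K p n _); apply: spull_ext.
  move=> n w; congr (fibhom_eval K p n _); apply: spull_ext => //=.
have atE e (H : smap (sprod X interval) (fibhom K p)) (l : smap X (fibhom K p)) :
    (forall n x, H n (x, dconst n e) = l n x) -> at_end e H = l.
  by move=> Hl; apply: smap_ext => n x; rewrite /= Hl.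
have [r0 r1] := rev_ord2.
suff both : homotopic g g' -> (null_along f g <-> null_along f g') by move=> /both[].
elim=> {g g'} [g g' [H [/atE H0 /atE H1]]|g|g g' _ ->|g g1 g' _ -> _ ->] //.
rewrite -H0 -H1; split; first by move/step; rewrite r0.
by move/step; rewrite r1.
Qed.

Definition svertex (X : sset) n (x : X n) : smap spoint X :=
  scomp (yoneda x) (@SMap spoint (simplex n) (fun m _ => dconst m ord0)
    (fun m k f _ => esym (dcomp_const ord0 f))).

Definition sempty : sset := disc False.

(** A horn contains the constant simplex at [k], so it has no map to the empty complex. *)
Lemma kan_sempty : kan sempty.
Proof.
move=> n k h; suff hk : in_horn k (dconst 0 k : simplex n.+1 0).
  by case: (h 0 (exist _ _ hk)).
exists (lift k ord0) => [e|_ /= e].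
  by have := neq_lift k ord0; rewrite e eqxx.
by have := neq_lift k ord0; rewrite -e eqxx.
Qed.

Lemma pullback_null (X P M K : sset) (f : smap X M) (p : smap P M)
    (c : smap spoint P) (phi : smap (spull f p) K) :
  weq f -> kan M -> kan K -> homotopy_lifting p ->
  homotopic (sid P) (scomp c (sterminal P)) ->
  exists d : smap spoint K, homotopic (scomp d (sterminal _)) phi.
Proof.
move=> wf hM hK hp hc.
have hQ : kan (fibhom K p) by apply: fibhom_kan.
have [h hf] := (wf _ hQ).2 (fibhom_curry phi).
(* Both maps agree up to homotopy after composition with [f], and [M] is a Kan complex. Lifting this
   homotopy then turns [h] into a strict section [s]. *)
have base : homotopic (scomp (fibhom_proj K p) h) (sid M).
  apply: (wf _ hM).1; rewrite -scompA.
  have -> : scomp (sid M) f = scomp (fibhom_proj K p) (fibhom_curry phi).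
    exact: smap_ext.
  exact: homotopic_compl.
have [s [ps hs]] := homotopic_lift (fibhom_homotopy_lifting hK hp) base erefl.
have es : scomp (fibhom_proj K p) (scomp s p) = scomp p (sid P).
  by rewrite scompA ps; apply: smap_ext.
pose psi := scomp (fibhom_eval K p) (spull_pair es).
(* Evaluation of the section factors through [psi], and [P] is contractible. *)
have ns : null_along f (scomp s f).
  move=> v ev; exists (scomp psi c).
  have -> : scomp (fibhom_eval K p) (spull_pair ev) = scomp (scomp psi (sid P)) v.
    apply: smap_ext => n w; congr (fibhom_eval K p n _); apply: spull_ext => //=.
    congr (s n _); rewrite -[RHS](congr1 (fun h : smap _ M => h n w) ev) /=.
    exact: (esym (congr1 (fun h : smap M M => h n (f n (sval w).1)) ps)).
  have -> : scomp (scomp psi c) (sterminal (spull f p)) =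
      scomp (scomp psi (scomp c (sterminal P))) v by apply: smap_ext.
  by apply: homotopic_comp; apply: homotopic_sym.
have nphi : null_along f (fibhom_curry phi).
  apply: null_along_homotopic hp _ ns.
  exact: homotopic_trans (homotopic_compr f (homotopic_sym hs)) hf.
(* At the canonical projection to [P], evaluating the transpose gives back [phi]. *)
have ev : scomp (fibhom_proj K p) (scomp (fibhom_curry phi) (spull_fst f p)) =
    scomp p (spull_snd f p).
  by apply: smap_ext => n w /=; rewrite (svalP w).
have [d hd] := nphi _ ev; exists d; congr (homotopic _ _): hd.
by apply: smap_ext => n w; congr (phi n _); apply: spull_ext => //=; rewrite sact1.
Qed.

Lemma pullback_weq (X P M : sset) (f : smap X M) (p : smap P M)
    (c : smap spoint P) :
  weq f -> kan M -> homotopy_lifting p ->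
  homotopic (sid P) (scomp c (sterminal P)) -> weq (sterminal (spull f p)).
Proof.
move=> wf hM hp hc.
(* An empty pullback would map to [sempty], and [pullback_null] would give that a point. *)
have [n [w _]] : exists n (w : spull f p n), True.
  apply: contrapT => hn.
  have e n (w : spull f p n) : False by apply: hn; exists n, w.
  have nat m n (u : dmap m n) x : e m (sact u x) = @sact sempty _ _ u (e n x).
    by case: (e n x).
  have [d _] := pullback_null (@SMap _ sempty e nat) wf hM kan_sempty hp hc.
  exact: (d 0 tt).
move=> K hK; split=> [g h gh|phi]; last exact: pullback_null hc.
(* A vertex of the pullback is a section of its map to the point. *)
have := homotopic_compr (svertex w) gh; rewrite -!scompA.
have -> : scomp (sterminal (spull f p)) (svertex w) = sid spoint.
  by apply: smap_ext => m [].
by rewrite !scomp1.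
Qed.

(** * Cosimplicial spaces *)

Lemma cnat_app (X Y : cspace) (f : cmap X Y) m n (t : dmap m n) k (x : X m k) :
  f n k (cact X t k x) = cact Y t k (f m k x).
Proof. exact: (congr1 (fun h : smap (X m) (Y n) => h k x) (cnat f t)). Qed.

Definition disc_map (S T : Type) (f : S -> T) : smap (disc S) (disc T) :=
  @SMap (disc S) (disc T) (fun _ => f) (fun _ _ _ _ => erefl).

(** The cosimplicial space freely generated by [L] in degree [n]; [cfree_ext] is its universal
    extension. *)
Program Definition cfree n (L : sset) : cspace :=
  @CSpace (fun m => sprod (disc (dmap n m)) L)
    (fun _ _ t => sprod_map (disc_map (dcomp t)) (sid L)) _ _.
Next Obligation. by apply: smap_ext => m [d l] /=; rewrite dcomp1f. Qed.
Next Obligation. by apply: smap_ext => q [d l] /=; rewrite -dcompA. Qed.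

Program Definition cfree_map n (L L' : sset) (i : smap L L') :
  cmap (cfree n L) (cfree n L') :=
  @CMap (cfree n L) (cfree n L') (fun m => sprod_map (sid _) i) _.
Next Obligation. exact: smap_ext. Qed.

Program Definition cfree_ext n (L : sset) (Z : cspace) (h : smap L (Z n)) :
  cmap (cfree n L) Z :=
  @CMap (cfree n L) Z
    (fun m => @SMap (sprod (disc (dmap n m)) L) (Z m)
      (fun k x => cact Z x.1 k (h k x.2)) _) _.
Next Obligation. by rewrite !snat. Qed.
Next Obligation. by apply: smap_ext => k [d l] /=; rewrite cactM. Qed.

Lemma strong_equiv_prodl e (D A B : sset) (i : smap A B) :
  strong_equiv e i -> strong_equiv e (sprod_map (sid D) i).
Proof.
move=> [g [hA [hB [A0 A1 B0 B1 AB]]]].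
pose h (C : sset) (hC : smap (sprod C interval) C) n
  (x : sprod (sprod D C) interval n) : sprod D C n := (x.1.1, hC n (x.1.2, x.2)).
have hnat C hC m n (f : dmap m n) x : @h C hC m (sact f x) = sact f (h C hC n x).
  by rewrite /h /= -snat.
exists (sprod_map (sid D) g), (SMap (hnat A hA)), (SMap (hnat B hB)).
by split=> n [d a] *; rewrite /= /h /= ?A0 ?A1 ?B0 ?B1 ?AB.
Qed.

(** The free map on a horn inclusion is a trivial cofibration, and an extension along it is a horn
    filler when read at the identity of [n]. *)
Lemma injective_fibrant_kan (Z : cspace) n : injective_fibrant Z -> kan (Z n).
Proof.
move=> hZ p k h.
pose i := cfree_map n (horn_incl k).
have [|m||H [Hi _]] := hZ _ _ i _ _ (cfree_ext h) (cterminal _).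
- by move=> m q [d x] [d' y] [-> e]; congr pair; exact: (@horn_incl_mono _ k).
- have [e he] := horn_strong_equiv k.
  exact: strong_equiv_weq (strong_equiv_prodl (disc (dmap n m)) he).
- by apply: cmap_ext => m; apply: smap_ext.
pose g q (x : simplex p.+1 q) : Z n q := H n q (did n, x).
have gnat q r (f : dmap q r) x : g q (sact f x) = sact f (g r x).
  by rewrite /g -snat.
exists (SMap gnat); apply: smap_ext => q x; rewrite /= /g.
rewrite -[LHS]/(ccomp H i n q (did n, x)) Hi /=.
by rewrite cact1.
Qed.

Lemma path_to_scomp (M N : sset) (f : smap M N) (x : smap spoint M)
    (y : smap spoint N) n (g : paths_to x n) :
  (forall n, f n (x n tt) = y n tt) -> path_to y (scomp f (sval g) : spath N n).
Proof. by move=> e m u; rewrite /= (svalP g). Qed.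

Program Definition paths_to_map (M N : sset) (f : smap M N) (x : smap spoint M)
  (y : smap spoint N) (e : forall n, f n (x n tt) = y n tt) :
  smap (paths_to x) (paths_to y) :=
  @SMap (paths_to x) (paths_to y)
    (fun n g => exist _ _ (path_to_scomp g e)) _.
Next Obligation. exact: paths_to_ext. Qed.

Lemma cpoint_act (Z : cspace) (z : cmap cpoint Z) m n
    (t : dmap m n) k : cact Z t k (z m k tt) = z n k tt.
Proof. by rewrite -(cnat_app z). Qed.

Lemma hfib_comm (X Z : cspace) (f : cmap X Z) (z : cmap cpoint Z) m n
    (t : dmap m n) :
  scomp (f n) (scomp (cact X t) (spull_fst (f m) (path_start (z m)))) =
  scomp (path_start (z n))
    (scomp (paths_to_map (cpoint_act z t)) (spull_snd (f m) (path_start (z m)))).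
Proof.
apply: smap_ext => k w /=; rewrite cnat_app (svalP w).
by rewrite /= /path_start_fun.
Qed.

Program Definition hfib (X Z : cspace) (f : cmap X Z) (z : cmap cpoint Z) : cspace :=
  @CSpace (fun n => spull (f n) (path_start (z n)))
    (fun m n t => spull_pair (hfib_comm f z t)) _ _.
Next Obligation.
apply: smap_ext => k w; apply: spull_ext => /=; first by rewrite cact1.
by apply: paths_to_ext => m u s /=; rewrite cact1.
Qed.
Next Obligation.
apply: smap_ext => k w; apply: spull_ext => /=; first by rewrite cactM.
by apply: paths_to_ext => q u s /=; rewrite cactM.
Qed.

Program Definition hfib_proj (X Z : cspace) (f : cmap X Z) (z : cmap cpoint Z) :
  cmap (hfib f z) X :=
  @CMap (hfib f z) X (fun n => spull_fst (f n) (path_start (z n))) _.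
Next Obligation. exact: smap_ext. Qed.

Lemma hfib_weq (X Z : cspace) (f : cmap X Z) (z : cmap cpoint Z) :
  cweq f -> injective_fibrant Z -> cweq (cterminal (hfib f z)).
Proof.
move=> wf hZ n; have hK := @injective_fibrant_kan _ n hZ.
apply: (pullback_weq (wf n) hK).
  exact: path_start_homotopy_lifting.
exact: paths_to_contractible.
Qed.

(** * Embedding in a pointed acyclic cosimplicial space *)

Lemma weq_cancel (X Y Z : sset) (p : smap Y Z) (i : smap X Y) :
  weq p -> weq (scomp p i) -> weq i.
Proof.
move=> wp wpi K hK; have [pinj psur] := wp K hK; have [inj sur] := wpi K hK.
split=> [g h gh|g].
  have [g' gg'] := psur g; have [h' hh'] := psur h.
  apply: (homotopic_trans (homotopic_sym gg') (homotopic_trans _ hh')).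
  apply/homotopic_compr/inj; rewrite !scompA.
  apply: (homotopic_trans (homotopic_compr i gg')).
  exact: (homotopic_trans gh (homotopic_sym (homotopic_compr i hh'))).
have [h hg] := sur g; exists (scomp h p); by rewrite -scompA.
Qed.

(* The product over [m] of the cofree simplicial sets on the pointed sets
   [option (S m)]. *)
Program Definition scofree (S : nat -> Type) : sset :=
  @SSet (fun n => forall m, dmap m n -> option (S m))
    (fun m n f v k t => v k (dcomp f t)) _ _.
Next Obligation.
by do 2!(apply: functional_extensionality_dep => ?); rewrite dcomp1f.
Qed.
Next Obligation.
by do 2!(apply: functional_extensionality_dep => ?); rewrite dcompA.
Qed.

Definition scofree_map (S T : nat -> Type) (f : forall n, S n -> T n) :
  smap (scofree S) (scofree T) :=
  @SMap (scofree S) (scofree T) (fun n v k t => omap (@f k) (v k t))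
    (fun _ _ _ _ => erefl).

Definition scofree_point (S : nat -> Type) : smap spoint (scofree S) :=
  @SMap spoint (scofree S) (fun _ _ _ _ => None) (fun _ _ _ _ => erefl).

Program Definition scofree_unit (X : sset) : smap X (scofree X) :=
  @SMap X (scofree X) (fun n x k t => Some (sact t x)) _.
Next Obligation.
by do 2!(apply: functional_extensionality_dep => ?); rewrite sactM.
Qed.

Lemma scofree_unit_mono (X : sset) : smono (scofree_unit X).
Proof.
move=> n x y e; have := congr1 (fun v : scofree X n => v n (did n)) e.
by rewrite /= !sact1 => -[].
Qed.

(** The coordinates obey no compatibility condition, so a contraction may keep the value at [t] when
    the parameter is 0 on all of [t], and put [None] otherwise. *)
Lemma scofree_weq (S : nat -> Type) : weq (sterminal (scofree S)).
Proof.
pose h n (x : sprod (scofree S) interval n) : scofree S n :=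
  fun k t => if [forall j, x.2 (t j) == ord0] then x.1 k t else None.
have hnat m n (f : dmap m n) x : h m (sact f x) = sact f (h n x) by [].
apply: (@homotopy_equiv_weq _ _ _ (scofree_point S)); last first.
  have -> : scomp (sterminal (scofree S)) (scofree_point S) = sid spoint.
    by apply: smap_ext => n [].
  exact: homotopic_refl.
apply/homotopic_sym/(@homotopic_ends ord0 _ _ (SMap hnat)) => n v;
  do 2!(apply: functional_extensionality_dep => ?); rewrite /= /h /=.
  by case: ifP => // /forallP[].
by case: ifP => // /forallP/(_ ord0).
Qed.

Program Definition ccofree (X : cspace) : cspace :=
  @CSpace (fun n => scofree (X n)) (fun m n t => scofree_map (cact X t)) _ _.
Next Obligation.
apply: smap_ext => k v; do 2!(apply: functional_extensionality_dep => ?).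
by rewrite /= cact1; case: (v _ _).
Qed.
Next Obligation.
apply: smap_ext => k v; do 2!(apply: functional_extensionality_dep => ?).
by rewrite /= cactM; case: (v _ _).
Qed.

Program Definition ccofree_unit (X : cspace) : cmap X (ccofree X) :=
  @CMap X (ccofree X) (fun n => scofree_unit (X n)) _.
Next Obligation.
apply: smap_ext => k v; do 2!(apply: functional_extensionality_dep => ?).
by rewrite /= snat.
Qed.

Program Definition ccofree_point (X : cspace) : cmap cpoint (ccofree X) :=
  @CMap cpoint (ccofree X) (fun n => scofree_point (X n)) _.
Next Obligation. exact: smap_ext. Qed.

(** By cancellation of weak equivalences the unit is a trivial cofibration, so [f] extends along it,
    and the base point of [ccofree U] is carried to [Z]. *)
Lemma acyclic_point (U Z : cspace) (f : cmap U Z) :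
  cweq (cterminal U) -> injective_fibrant Z -> inhabited (cmap cpoint Z).
Proof.
move=> wU hZ; have [n|n||h _] := hZ _ _ (ccofree_unit U) _ _ f (cterminal _).
- exact: scofree_unit_mono.
- apply: (@weq_cancel _ _ _ (sterminal _)); first exact: scofree_weq.
  by congr weq: (wU n); apply: smap_ext.
- by apply: cmap_ext => n; apply: smap_ext.
exact: (inhabits (ccomp h (ccofree_point U))).
Qed.

Program Definition cfst (X : cspace) (K : sset) : cmap (cprod X K) X :=
  @CMap (cprod X K) X (fun n => sfst (X n) K) _.
Next Obligation. exact: smap_ext. Qed.

Program Definition cprod_vertex n : cmap cpoint (cprod cpoint (simplex n)) :=
  @CMap cpoint (cprod cpoint (simplex n))
    (fun m => @SMap spoint (sprod spoint (simplex n))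
      (fun k _ => (tt, dconst k ord0)) _) _.
Next Obligation. by congr pair; apply/esym/dcomp_const. Qed.
Next Obligation. exact: smap_ext. Qed.

Theorem lemma6 (X : cspace) (M : injective_fibrant_model X) :
  snonempty (Tot M) <->
  exists (U : cspace) (f : cmap U X), cweq (cterminal U).
Proof.
split=> [[n [c]]|[U [f wU]]].
  (* A simplex of any dimension yields a point through its first vertex. *)
  pose z := ccomp (c : cmap (cprod cpoint (simplex n)) M) (cprod_vertex n).
  exists (hfib (model_map M) z), (hfib_proj (model_map M) z).
  exact: hfib_weq (@model_weq X M) (@model_fibrant X M).
have [z] := acyclic_point (ccomp (model_map M) f) wU (@model_fibrant X M).
by exists 0; constructor; exact: (ccomp z (cfst cpoint (simplex 0))).
Qed.
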